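(* Let $\mathcal{G}$ be a graph of groups in which each vertex group is sofic and each edge group is amenable. Then the fundamental group of $\mathcal{G}$ is sofic.
   Context: A graph of groups $\mathcal{G}$ consists of: (1) a connected graph $\Gamma$ (loops are allowed, but no multiple edges) with vertex set $V$ and edge set $E$; (2) vertex groups $G_v$ ($v\in V$) and edge groups $G_e$ ($e\in E$); (3) for each edge $e=\{v_1,v_2\}$ of $\Gamma$, monomorphisms $\theta^1_e:G_e\to G_{v_1}$ and $\theta^2_e:G_e\to G_{v_2}$ (each edge being given a fixed orientation). Fundamental group: choose a spanning tree $T$ of $\Gamma$. The fundamental group $\pi_1(\mathcal{G},T)$ is the group generated by the groups $G_v$ ($v\in V$) together with generators $t_e$, one for each (oriented) edge $e\in E$, subject to the relations: (1) all the relations of the groups $G_v$; (2) $t_e^{-1}\theta^1_e(g)t_e=\theta^2_e(g)$ for each $e\in E$, $g\in G_e$; (3) $t_e=1$ for each edge $e$ of $T$. Up to isomorphism this group does not depend on the choice of $T$. Amenability is that of discrete groups. For a finite nonempty set $A$, let $\mathcal{S}(A)$ be the group of all permutations of $A$, acting on the right (so in a product $f_1f_2$ the permutation $f_1$ is applied first). For $\epsilon>0$, two elements $f_1,f_2\in\mathcal{S}(A)$ are $\epsilon$-similar if the number of $a\in A$ with $f_1(a)\neq f_2(a)$ is at most $\epsilon|A|$. Let $G$ be a group, $\epsilon>0$ a real number and $F\subseteq G$ a finite subset. A special $(F,\epsilon)$-quasi-action of $G$ on a finite nonempty set $A$ is a function $\phi:G\to\mathcal{S}(A)$ such that: (a)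 $\phi(1)=1$; (b) $\phi(g)^{-1}=\phi(g^{-1})$ for all $g\in G$; (c) for every $g\in F\setminus\{1\}$, $\phi(g)$ has no fixed points; (d) for all $g_1,g_2\in F$, $\phi(g_1g_2)$ is $\epsilon$-similar to $\phi(g_1)\phi(g_2)$. A group $G$ is sofic if for every $\epsilon\in(0,1)$ and every finite subset $F\subseteq G$, $G$ admits a special $(F,\epsilon)$-quasi-action on some finite nonempty set. *)

(* Defs.v *)
From HB Require Import structures.
From mathcomp Require Import all_boot all_order all_algebra all_fingroup.
From mathcomp Require Import boolp classical_sets cardinality reals.

Set Implicit Arguments.
Unset Strict Implicit.
Unset Printing Implicit Defensive.

Import Order.TTheory GRing.Theory Num.Theory.

Local Open Scope classical_set_scope.
Local Open Scope group_scope.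

(* Multiplication in {perm A} is (s * t) a = t (s a), i.e. permutations act on
   the right. *)
Definition eps_similar (R : realType) (A : finType) (eps : R) (f1 f2 : {perm A}) :
  Prop := (#|[set a | f1 a != f2 a]%SET|%:R <= eps * #|A|%:R)%R.

Record special_quasi_action (R : realType) (G : groupType) (F : set G)
    (eps : R) (A : finType) (phi : G -> {perm A}) : Prop := {
  quasi_action1 : phi 1 = 1;
  quasi_actionV : forall g, (phi g)^-1 = phi g^-1;
  quasi_action_free : forall g, F g -> g <> 1 -> forall a, phi g a <> a;
  quasi_actionM : forall g1 g2, F g1 -> F g2 ->
    eps_similar eps (phi (g1 * g2)) (phi g1 * phi g2) }.

Definition sofic (R : realType) (G : groupType) : Prop :=
  forall (eps : R) (F : set G), (0 < eps < 1)%R -> finite_set F ->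
  exists (A : finType) (phi : G -> {perm A}),
    (0 < #|A|)%N /\ special_quasi_action F eps phi.

(* Discrete amenability in the sense of von Neumann: a left-invariant, finitely
   additive probability measure defined on all subsets. *)
Definition amenable (R : realType) (G : groupType) : Prop :=
  exists mu : set G -> R,
    [/\ forall A, (0 <= mu A)%R,
        mu setT = 1%R,
        forall A B, A `&` B = set0 -> mu (A `|` B) = (mu A + mu B)%R
      & forall g A, mu [set g * x | x in A] = mu A].

(* Graphs, possibly infinite, with loops but without multiple edges: an edge is
   determined by its unordered pair of end points. *)
Record graph := Graph {
  vertex : choiceType;
  edge : choiceType;
  src : edge -> vertex;
  tgt : edge -> vertex;
  edge_simple : forall e f,
    (src e = src f /\ tgt e = tgt f) \/ (src e = tgt f /\ tgt e = src f) ->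
    e = f }.

Section Graphs.
Variable Gamma : graph.

(* (e, false) is e traversed from src e to tgt e, (e, true) its reverse. *)
Definition dart : Type := (edge Gamma * bool)%type.
Definition origin (d : dart) := if d.2 then tgt d.1 else src d.1.
Definition terminus (d : dart) := if d.2 then src d.1 else tgt d.1.

Fixpoint walk (u : vertex Gamma) (p : seq dart) (v : vertex Gamma) : Prop :=
  if p is d :: q then origin d = u /\ walk (terminus d) q v else u = v.

Definition walk_in (T : set (edge Gamma)) u p v :=
  walk u p v /\ {in p, forall d : edge Gamma * bool, T d.1}.

Definition connected_by (T : set (edge Gamma)) : Prop :=
  (exists v : vertex Gamma, True) /\ forall u v, exists p, walk_in T u p v.

(* A cycle is a nonempty closed walk that repeats neither an edge nor a vertex
   (apart from its base point); a loop is a cycle of length one. *)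
Definition acyclic (T : set (edge Gamma)) : Prop :=
  forall u p, walk_in T u p u -> uniq (map fst p) -> uniq (map origin p) ->
  p = [::].

Definition spanning_tree (T : set (edge Gamma)) : Prop :=
  connected_by T /\ acyclic T.

End Graphs.

Record graph_of_groups := GraphOfGroups {
  base_graph :> graph;
  base_connected : connected_by [set: edge base_graph];
  vgroup : vertex base_graph -> groupType;
  egroup : edge base_graph -> groupType;
  theta1 : forall e, {multiplicative egroup e -> vgroup (src e)};
  theta2 : forall e, {multiplicative egroup e -> vgroup (tgt e)};
  theta1_inj : forall e, injective (theta1 e);
  theta2_inj : forall e, injective (theta2 e) }.

Section Presentation.
Variable X : choiceType.

(* The letter (x, false) stands for x and (x, true) for its inverse. *)
Notation word := (seq (X * bool)).

Definition word_inv (w : word) : word := rev [seq (l.1, ~~ l.2) | l <- w].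

Variable rels : word -> word -> Prop.

Inductive word_eq : word -> word -> Prop :=
| word_eq_refl u : word_eq u u
| word_eq_sym u v : word_eq u v -> word_eq v u
| word_eq_trans u v w : word_eq u v -> word_eq v w -> word_eq u w
| word_eq_cat u u' v v' :
    word_eq u u' -> word_eq v v' -> word_eq (u ++ v) (u' ++ v')
| word_eq_cancel x b : word_eq [:: (x, b); (x, ~~ b)] [::]
| word_eq_rel u v : rels u v -> word_eq u v.

Definition word_eqb (u v : word) : bool := `[< word_eq u v >].

Lemma word_eqb_refl : reflexive word_eqb.
Proof. by move=> u; apply/asboolP/word_eq_refl. Qed.

Lemma word_eqb_sym : symmetric word_eqb.
Proof. by move=> u v; apply/asboolP/asboolP; exact: word_eq_sym. Qed.

Lemma word_eqb_trans : transitive word_eqb.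
Proof.
by move=> v u w /asboolP uv /asboolP vw; apply/asboolP/(word_eq_trans uv vw).
Qed.

Canonical word_eqb_equiv :=
  EquivRel word_eqb word_eqb_refl word_eqb_sym word_eqb_trans.

Local Open Scope quotient_scope.

(* The group with generators X and defining relations u = v for rels u v. *)
Definition presented : Type := {eq_quot word_eqb}.
HB.instance Definition _ := Choice.copy presented {eq_quot word_eqb}.

Definition wclass (w : word) : presented := \pi_({eq_quot word_eqb}) w.
Definition wrepr (x : presented) : word := generic_quotient.repr (x : {eq_quot word_eqb}).

Lemma wreprK x : wclass (wrepr x) = x.
Proof. exact: reprK. Qed.

Lemma wclassP u v : wclass u = wclass v <-> word_eq u v.
Proof.
split=> [/eqP|uv]; first by rewrite /wclass piE => /asboolP.
by apply/eqP; rewrite /wclass piE; apply/asboolP.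
Qed.

Lemma wrepr_class u : word_eq (wrepr (wclass u)) u.
Proof. by apply/wclassP; rewrite wreprK. Qed.

Lemma word_invK : involutive word_inv.
Proof.
move=> u; rewrite /word_inv map_rev revK -map_comp -[RHS]map_id.
by apply: eq_map => -[x b] /=; rewrite negbK.
Qed.

Lemma word_inv_cat u v : word_inv (u ++ v) = word_inv v ++ word_inv u.
Proof. by rewrite /word_inv map_cat rev_cat. Qed.

Lemma word_mulV u : word_eq (u ++ word_inv u) [::].
Proof.
elim: u => [|[x b] u IHu]; first exact: word_eq_refl.
rewrite -cat1s word_inv_cat -catA [u ++ _]catA.
apply: word_eq_trans (word_eq_cancel x b).
apply: word_eq_cat (word_eq_refl _) _.
exact: word_eq_cat IHu (word_eq_refl _).
Qed.

Lemma word_Vmul u : word_eq (word_inv u ++ u) [::].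
Proof. by rewrite -{2}[u]word_invK; exact: word_mulV. Qed.

Lemma word_eq_inv u v : word_eq u v -> word_eq (word_inv u) (word_inv v).
Proof.
move=> uv; rewrite -[X in word_eq X _]cats0.
apply: (@word_eq_trans _ (word_inv u ++ v ++ word_inv v)).
  by apply: word_eq_cat (word_eq_refl _) (word_eq_sym (word_mulV v)).
rewrite catA -[X in word_eq _ X]cat0s.
apply: word_eq_cat (word_eq_refl _).
apply: word_eq_trans (word_Vmul u).
exact: word_eq_cat (word_eq_refl _) (word_eq_sym uv).
Qed.

Definition pres_one : presented := wclass [::].
Definition pres_mul (x y : presented) : presented :=
  wclass (wrepr x ++ wrepr y).
Definition pres_inv (x : presented) : presented := wclass (word_inv (wrepr x)).

Lemma pres_mulE u v : pres_mul (wclass u) (wclass v) = wclass (u ++ v).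
Proof. by apply/wclassP/word_eq_cat; exact: wrepr_class. Qed.

Lemma pres_invE u : pres_inv (wclass u) = wclass (word_inv u).
Proof. by apply/wclassP/word_eq_inv/wrepr_class. Qed.

Lemma pres_mulA : associative pres_mul.
Proof.
by move=> x y z; rewrite -[x]wreprK -[y]wreprK -[z]wreprK !pres_mulE catA.
Qed.

Lemma pres_mul1 : left_id pres_one pres_mul.
Proof. by move=> x; rewrite -[x]wreprK pres_mulE. Qed.

Lemma pres_mulr1 : right_id pres_one pres_mul.
Proof. by move=> x; rewrite -[x]wreprK pres_mulE cats0. Qed.

Lemma pres_mulVl : left_inverse pres_one pres_inv pres_mul.
Proof.
move=> x; rewrite -[x]wreprK pres_invE pres_mulE.
by apply/wclassP/word_Vmul.
Qed.

Lemma pres_mulVr : right_inverse pres_one pres_inv pres_mul.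
Proof.
move=> x; rewrite -[x]wreprK pres_invE pres_mulE.
by apply/wclassP/word_mulV.
Qed.

HB.instance Definition _ := isGroup.Build presented
  pres_mulA pres_mul1 pres_mulr1 pres_mulVl pres_mulVr.

End Presentation.

Section FundamentalGroup.
Variables (GG : graph_of_groups) (T : set (edge GG)).

Definition pi1_gen : choiceType :=
  ({v : vertex GG & vgroup v} + edge GG)%type.

Definition vletter (v : vertex GG) (g : vgroup v) : pi1_gen * bool :=
  (inl (Tagged (@vgroup GG) g), false).
Definition stable (e : edge GG) : pi1_gen * bool := (inr e, false).
Definition stableV (e : edge GG) : pi1_gen * bool := (inr e, true).

(* All relations of a vertex group follow from its multiplication table. *)
Inductive pi1_rels : seq (pi1_gen * bool) -> seq (pi1_gen * bool) -> Prop :=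
| pi1_vertex v (g h : vgroup v) :
    pi1_rels [:: vletter g; vletter h] [:: vletter (g * h)]
| pi1_edge e (g : egroup e) :
    pi1_rels [:: stableV e; vletter (theta1 e g); stable e]
             [:: vletter (theta2 e g)]
| pi1_tree e : T e -> pi1_rels [:: stable e] [::].

Definition pi1 : groupType := presented pi1_rels.

End FundamentalGroup.

(* Main.v *)
(* It suffices to find, for every finite part of the presentation, permutations of
   a finite set that almost satisfy the relations and under which every nontrivial
   reduced form (the normal form of Bass-Serre theory) moves almost all points.

   Let all vertex groups quasi-act on one finite set [A], and let [H] be an edge
   group with the two actions [al], [be] on [A] that it inherits. If [T] is a
   Folner set of [H] and [w] is a random ordering of [A], let the centre of [a]
   be the [w]-least point of the tile [a T]. As [a T] and [a h T] almost coincide,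
   [a] and [a h] have the same centre with high probability, so writing the
   centre as [a t] gives an almost equivariant label [t] of [a] in [H]. Over
   [(A * orderings) * (A * orderings)], twisting the second copy of [A] by the
   label of the first turns the action [al] on the first factor into the
   diagonal action, which is symmetric in [al] and [be]; hence [al] and [be]
   become almost conjugate by an explicit permutation.

   To make these conjugations free, a further coordinate in a finite group [Q] is
   multiplied, at each traversal of an edge, by a generator indexed by the edge and
   the two centres. An element outside the edge group moves a point to another tile,
   so a reduced form multiplies the [Q]-coordinate by a reduced word in these
   generators, and [Q] is chosen so that no short reduced word is trivial. *)
Require Import Defs.
From mathcomp Require Import all_boot all_order all_algebra all_fingroup.
From mathcomp Require Import boolp classical_sets cardinality reals.
From mathcomp Require Import finmap zify lra.

Set Implicit Arguments.
Unset Strict Implicit.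
Unset Printing Implicit Defensive.

Import Order.TTheory GRing.Theory Num.Theory.

Local Open Scope group_scope.

(** * Hall's theorem and Folner sets *)

Section Hall.
Variables I K : choiceType.
Local Open Scope fset_scope.

Definition cover_fset (N : I -> {fset K}) (J : {fset I}) : {fset K} :=
  \bigcup_(i <- J) N i.

Definition hall (N : I -> {fset K}) : Prop :=
  forall J : {fset I}, (#|` J| <= #|` cover_fset N J|)%N.

Lemma cover_fsetP N J k :
  reflect (exists2 i, i \in J & k \in N i) (k \in cover_fset N J).
Proof.
apply: (iffP idP) => [/bigfcupP[i /andP[iJ _] kN]|[i iJ kN]]; first by exists i.
by apply/bigfcupP; exists i; rewrite ?iJ.
Qed.

Lemma cover_fset_eq N M J : {in J, N =1 M} -> cover_fset N J = cover_fset M J.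
Proof.
move=> NM; apply/fsetP => k; apply/cover_fsetP/cover_fsetP => -[i iJ ki];
  by exists i; rewrite // ?NM // -NM.
Qed.

(** At each index the sets of the chain are finite, so one of least size lies in all the others. On
    a finite [J] one member of the chain attains all these minima, so the intersection inherits
    Hall's condition. *)
Lemma hall_chain_min (N : I -> {fset K}) (A : set (I -> {fset K})) :
  hall N -> A N -> (forall M, A M -> hall M) ->
  total_on A (fun M M' => `[< forall i, M' i `<=` M i >]) ->
  exists2 M, hall M & forall M', A M' -> forall i, M i `<=` M' i.
Proof.
move=> hN AN hA totA.
have /choice[L LP] i : exists M, A M /\ forall M', A M' -> M i `<=` M' i.
  have ex : exists n, `[< exists2 M, A M & #|` M i| = n >].
    by exists #|` N i|; apply/asboolP; exists N.
  case: (ex_minnP ex) => n /asboolP[M AM Mn] minn.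
  exists M; split=> // M' AM'.
  case: (totA _ _ AM AM') => /asboolP /(_ i) // sub.
  suff /eqP-> : M' i == M i by [].
  rewrite eqEfcard sub Mn /=; apply: minn; apply/asboolP; by exists M'.
exists (fun i => L i i); last by move=> M' AM' i; exact: (LP i).2.
move=> J.
suff [M AM MJ] : exists2 M, A M & {in J, forall i, M i = L i i}.
  by rewrite -(cover_fset_eq MJ); exact: hA.
suff [M AM MJ] : exists2 M, A M & {in (J : seq I), forall i, M i `<=` L i i}.
  exists M => // i iJ; apply/eqP; rewrite eqEfsubset MJ //.
  exact: (LP i).2.
elim: (J : seq I) => [|i s [M AM Ms]]; first by exists N.
have [ALi minLi] := LP i.
case: (totA _ _ AM ALi) => /asboolP sub.
  exists (L i) => // j; rewrite inE => /orP[/eqP->|/Ms] //.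
  exact: fsubset_trans.
exists M => // j; rewrite inE => /orP[/eqP->|/Ms] //.
Qed.

Definition remove_at (N : I -> {fset K}) i y j :=
  if j == i then N j `\ y else N j.

(** A set violating Hall's condition after the removal must contain [i]. Splitting [i] off gives a
    form in which two such sets can be compared. *)
Lemma not_hall_remove N i y : hall N -> ~ hall (remove_at N i y) ->
  exists2 J : {fset I}, i \notin J &
    (#|` cover_fset N J `|` (N i `\ y)| <= #|` J|)%N.
Proof.
move=> hN /existsNP[J /negP]; rewrite -ltnNge => ltJ.
have iJ : i \in J.
  apply/negPn/negP => iJ; move: ltJ; rewrite (@cover_fset_eq _ N).
    by rewrite ltnNge hN.
  by move=> j jJ; rewrite /remove_at; case: eqP => // ji; rewrite -ji jJ in iJ.
exists (J `\ i); first by rewrite !inE eqxx.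
rewrite -ltnS.
have -> : #|` J `\ i|.+1 = #|` J| by rewrite (cardfsD1 i J) iJ.
apply: leq_ltn_trans ltJ; apply: fsubset_leq_card; apply/fsubsetP => k.
rewrite in_fsetU => /orP[/cover_fsetP[j]|kN].
  rewrite !inE => /andP[ji jJ] kN; apply/cover_fsetP; exists j => //.
  by rewrite /remove_at (negPf ji).
by apply/cover_fsetP; exists i => //; rewrite /remove_at eqxx.
Qed.

(* Rado's argument: in a minimal family satisfying Hall's condition every set is
   a singleton, since otherwise two elements of [N i] could each not be removed,
   which contradicts the submodularity of [J |-> #|cover_fset N J|]. *)
Lemma hall_minimal_inj N : hall N ->
  (forall M, hall M -> (forall i, M i `<=` N i) -> M = N) ->
  exists f : I -> K, injective f /\ forall i, f i \in N i.
Proof.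
move=> hN minN.
have card1 i : #|` N i| = 1%N.
  apply/eqP; rewrite eqn_leq; apply/andP; split; last first.
    have := hN [fset i]; rewrite cardfs1.
    suff -> : cover_fset N [fset i] = N i by [].
    apply/fsetP => k; apply/cover_fsetP/idP => [[j]|ki].
      by rewrite inE => /eqP->.
    by exists i => //; rewrite inE.
  rewrite leqNgt; apply/negP => gt1.
  have /fset0Pn[y yN] : N i != fset0 by rewrite -cardfs_gt0 ltnW.
  have /fset0Pn[z] : N i `\ y != fset0.
    by rewrite -cardfs_gt0; rewrite (cardfsD1 y) yN in gt1.
  rewrite !inE eq_sym => /andP[yz zN].
  have rem w : w \in N i -> ~ hall (remove_at N i w).
    move=> wN /minN eN.
    have : N i = remove_at N i w i.
      by rewrite -{1}eN // => j; rewrite /remove_at; case: ifP => // _; exact: fsubD1set.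
    move/fsetP/(_ w); rewrite /remove_at eqxx !inE eqxx wN //.
  have [J1 iJ1 c1] := not_hall_remove hN (rem _ yN).
  have [J2 iJ2 c2] := not_hall_remove hN (rem _ zN).
  set A1 := (X in #|` X|) in c1; set A2 := (X in #|` X|) in c2.
  (* As [y] and [z] differ, [N i] without [y] and [N i] without [z] together cover [N i]. *)
  have cU : (#|` i |` (J1 `|` J2)| <= #|` A1 `|` A2|)%N.
    apply: leq_trans (hN _) _; apply: fsubset_leq_card; apply/fsubsetP => k.
    case/cover_fsetP=> j; rewrite !inE => /or3P[/eqP->|jJ|jJ] kj.
    - have [->|ky] := eqVneq k y; last by rewrite kj ?orbT.
      by rewrite yz yN !orbT.
    - have -> : k \in cover_fset N J1 by apply/cover_fsetP; exists j.
      by [].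
    - have -> : k \in cover_fset N J2 by apply/cover_fsetP; exists j.
      by rewrite !orbT.
  have cI : (#|` J1 `&` J2| <= #|` A1 `&` A2|)%N.
    apply: leq_trans (hN _) _; apply: fsubset_leq_card; apply/fsubsetP => k.
    case/cover_fsetP=> j; rewrite !inE => /andP[j1 j2] kj.
    have -> : k \in cover_fset N J1 by apply/cover_fsetP; exists j.
    have -> : k \in cover_fset N J2 by apply/cover_fsetP; exists j.
    by [].
  have eA := cardfsUI A1 A2; have eJ := cardfsUI J1 J2.
  have : #|` i |` (J1 `|` J2)| = #|` J1 `|` J2|.+1.
    by rewrite cardfsU1 inE negb_or iJ1 iJ2.
  lia.
have /choice[f fP] i : exists k, N i = [fset k].
  by have /eqP/cardfs1P[k] := card1 i; exists k.
exists f; split=> [i j fij|i]; last by rewrite fP inE.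
apply/eqP/negPn/negP => ij.
have := hN [fset i; j]; rewrite cardfs2 ij.
have -> : cover_fset N [fset i; j] = [fset f i].
  apply/fsetP => k; apply/cover_fsetP/idP => [[l]|].
    by rewrite !inE => /orP[/eqP->|/eqP->]; rewrite fP inE ?fij.
  by move=> ki; exists i; rewrite ?inE ?eqxx // fP.
by rewrite cardfs1.
Qed.

(** Zorn's lemma, for subfamilies of [N] with Hall's condition under reverse inclusion, provides a
    minimal one. *)
Lemma hall_theorem N : hall N ->
  exists f : I -> K, injective f /\ forall i, f i \in N i.
Proof.
move=> hN.
pose T := {M : I -> {fset K} | hall M /\ forall i, M i `<=` N i}.
pose r (s t : T) := `[< forall i, sval t i `<=` sval s i >].
have [] := @Zorn T r.
- by move=> t; apply/asboolP.
- move=> s t u /asboolP st /asboolP tu; apply/asboolP => i.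
  exact: fsubset_trans (tu i) (st i).
- move=> [s sP] [t tP] /asboolP/= st /asboolP/= ts; apply: eq_exist.
  by apply/funext => i; apply/eqP; rewrite eqEfsubset st ts.
- move=> A totA.
  have [[t0 At0]|/forallNP noA] := pselect (exists t0, A t0); last first.
    by exists (exist _ N (conj hN (fun=> fsubset_refl _))) => s /noA.
  pose A' := [set sval t | t in A]%classic.
  have [||_ [t _ <-]||M hM minM] := @hall_chain_min (sval t0) A'.
  + exact: (proj2_sig t0).1.
  + by exists t0.
  + exact: (proj2_sig t).1.
  + by move=> _ _ [s As <-] [t At <-]; exact: totA.
  have MN i : M i `<=` N i.
    by apply: fsubset_trans (minM _ _ i) ((proj2_sig t0).2 i); exists t0.
  exists (exist _ M (conj hM MN)) => s As; apply/asboolP => i.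
  by apply: minM; exists s.
move=> [M [hM MN]] maxM.
have [|f [finj fM]] := @hall_minimal_inj M hM; last first.
  by exists f; split=> // i; exact: (fsubsetP (MN i)).
move=> M' hM' M'M.
have M'N i : M' i `<=` N i by apply: fsubset_trans (M'M i) (MN i).
have := maxM (exist _ M' (conj hM' M'N)).
by move=> /(_ (asboolT M'M)) /(congr1 sval).
Qed.

End Hall.

(** * Folner sets from an invariant mean *)

Section Folner.
Variables (R : realType) (H : groupType).
Local Open Scope fset_scope.
Local Open Scope group_scope.

Definition dilate (K T : {fset H}) : {fset H} :=
  [fset p.1 * p.2 | p in K `*` T]%fset.

Lemma dilateP (K T : {fset H}) x :
  reflect (exists k t, [/\ k \in K, t \in T & x = k * t]) (x \in dilate K T).
Proof.
apply: (iffP (imfsetP _ _ _ _)) => [[[k t] /=]|[k [t [kK tT ->]]]].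
  by rewrite in_fsetM /= => /andP[kK tT] ->; exists k, t.
by exists (k, t) => //=; rewrite in_fsetM kK.
Qed.

(** Iterated dilation by [K] is a single dilation by the finite set of [n]-fold products of [K]. *)
Lemma iter_dilateP (K T : {fset H}) n x :
  reflect (exists k t, [/\ k \in iter n (dilate K) [fset 1], t \in T & x = k * t])
    (x \in iter n (dilate K) T).
Proof.
elim: n x => [|n IHn] x.
  apply: (iffP idP) => [xT|[k [t [/fset1P-> tT ->]]]]; last by rewrite mul1g.
  by exists 1, x; rewrite inE eqxx mul1g.
apply: (iffP (dilateP _ _ _)) => [[k [y [kK /IHn[l [t [lK tT ->]]] ->]]]|].
  by exists (k * l), t; rewrite mulgA; split=> //; apply/dilateP; exists k, l.
case=> [l [t [/dilateP[k [l' [kK l'K ->]]] tT ->]]].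
by exists k, (l' * t); rewrite mulgA; split=> //; apply/IHn; exists l', t.
Qed.

Variable mu : set H -> R.
Hypothesis mu_ge0 : forall A, (0 <= mu A)%R.
Hypothesis muT : mu [set: H] = 1%R.
Hypothesis muU : forall A B, (A `&` B = set0)%classic ->
  mu (A `|` B)%classic = (mu A + mu B)%R.
Hypothesis muM : forall g A, mu [set (g * x)%g | x in A]%classic = mu A.

Lemma mean0 : mu set0 = 0%R.
Proof.
have := @muU set0 set0 (set0I _); rewrite set0U => h.
by apply: (addrI (mu set0)); rewrite addr0 -h.
Qed.

(** Where [f x * x^-1] equals a given [s], [f] is left translation by [s], which preserves [mu].
    Finitely many such pieces cover [H], and their images are disjoint by injectivity. *)
Lemma mean_piecewise_translation (f : H -> H) (S : {fset H}) :
  injective f -> (forall x, f x * x^-1 \in S) -> mu (range f) = 1%R.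
Proof.
move=> finj fS.
pose D (s : seq H) := [set x | f x * x^-1 \in s]%classic.
have DT : D S = [set: H]%classic by apply/seteqP; split=> // x _; exact: fS.
rewrite -muT -DT; elim: (S : seq H) => [|s l IHl].
  have -> : D [::] = set0 by apply/seteqP; split.
  by rewrite image_set0 mean0.
have [sl|sl] := boolP (s \in l).
  suff -> : D (s :: l) = D l by [].
  by apply/seteqP; split=> x; rewrite /D /= inE; [case/orP => // /eqP-> | move=> ->; rewrite orbT].
pose Ds := [set x | f x * x^-1 = s]%classic.
have eD : D (s :: l) = (Ds `|` D l)%classic.
  apply/seteqP; split=> x; rewrite /D /Ds /= inE.
    by case/orP => [/eqP|]; [left|right].
  by case=> [->|->]; rewrite ?eqxx ?orbT.
have dis : (Ds `&` D l = set0)%classic.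
  apply/seteqP; split=> // x [xs xl]; case/negP: sl.
  by have <- : f x * x^-1 = s := xs.
rewrite eD image_setU !muU // -?IHl.
- congr (_ + _)%R; rewrite -(muM s Ds); congr mu.
  apply/seteqP; split=> _ [x Dx <-]; exists x => //;
    by have <- : f x * x^-1 = s := Dx; rewrite mulgKV.
- apply/seteqP; split=> // _ [[x Dx <-] [y Dy /finj xy]].
  rewrite xy in Dy.
  have : (Ds `&` D l)%classic x by [].
  by rewrite dis.
Qed.

(** Doubling is Hall's condition for the family sending both copies of [x] to [S x]. A matching
    would be a paradoxical decomposition: two injective piecewise translations with disjoint ranges,
    each of mean 1. *)
Lemma not_doubling (S : {fset H}) :
  ~ forall T : {fset H}, (2 * #|` T| <= #|` dilate S T|)%N.
Proof.
move=> dbl.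
pose N (p : H * bool) := dilate S [fset p.1].
have hN : hall N.
  move=> J; pose J1 := [fset p.1 | p in J].
  have JJ : (#|` J| <= 2 * #|` J1|)%N.
    pose Jb (b : bool) := [fset (x, b) | x in J1].
    have cJb b : (#|` Jb b| <= #|` J1|)%N by apply: leq_imfset_card.
    apply: (@leq_trans #|` Jb true `|` Jb false|); last first.
      by apply: leq_trans (leq_card_fsetU _ _) _; rewrite mul2n -addnn leq_add.
    apply: fsubset_leq_card; apply/fsubsetP => -[x b] pJ; rewrite inE.
    have xJ1 : x \in J1 by apply/imfsetP; exists (x, b).
    by case: b {pJ} => //; apply/orP; [left|right]; apply/imfsetP; exists x.
  apply: leq_trans JJ _; apply: leq_trans (dbl _) _.
  apply: fsubset_leq_card; apply/fsubsetP => x /dilateP[s [t [sS tJ ->]]].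
  case/imfsetP: tJ => p /= pJ ->; apply/cover_fsetP; exists p => //.
  by apply/dilateP; exists s, p.1; rewrite inE.
have [f [finj fN]] := hall_theorem hN.
have fb b : mu (range (fun x => f (x, b))) = 1%R.
  apply: (@mean_piecewise_translation _ S).
    by move=> x y /finj [].
  move=> x; have /dilateP[s [t [sS /fset1P /= -> ->]]] := fN (x, b).
  by rewrite mulgK.
pose f' b := range (fun x => f (x, b)).
have dis : (f' true `&` f' false = set0)%classic.
  by apply/seteqP; split=> // _ [[x _ <-] [y _ /finj]].
have := muU dis; rewrite !fb => e2.
have := muU (setICr (f' true `|` f' false)%classic); rewrite setUv muT e2.
have := mu_ge0 (~` (f' true `|` f' false))%classic; lra.
Qed.

(** Otherwise [1] and [K] together enlarge every finite set by the factor [1 + eps], and enough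
    iterations double every finite set. *)
Lemma mean_folner (K : seq H) (eps : R) : (0 < eps)%R -> exists T : seq H,
  [/\ T <> [::], uniq T & {in K, forall h,
    (count (fun t => (h * t)%g \notin T) T)%:R <= eps * (size T)%:R}]%R.
Proof.
move=> eps_gt0; apply: contrapT => noT.
pose K1 : {fset H} := [fset x in 1 :: K].
have grow (T : {fset H}) : ((1 + eps) * #|` T|%:R <= #|` dilate K1 T|%:R)%R.
  have [->|T0] := eqVneq T fset0; first by rewrite cardfs0 mulr0.
  apply: contrapT => small; apply: noT; exists T; split=> //.
  - by move=> Te; rewrite -cardfs_gt0 Te in T0.
  - exact: fset_uniq.
  move=> h hK; rewrite leNgt; apply/negP => big; apply: small.
  pose T' := [fset (h * t)%g | t in [seq t <- T | (h * t)%g \notin T]].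
  have cT' : #|` T'| = count (fun t => (h * t)%g \notin T) T.
    rewrite card_imfset /=; last by move=> x y /mulgI.
    by rewrite undup_id ?size_filter // filter_uniq // fset_uniq.
  have sub : (T `|` T')%fset `<=` dilate K1 T.
    apply/fsubsetP => x; rewrite inE => /orP[xT|/imfsetP[t /=]].
      by apply/dilateP; exists 1, x; rewrite mul1g !inE eqxx.
    rewrite mem_filter => /andP[_ tT] ->; apply/dilateP; exists h, t.
    by rewrite !inE hK orbT.
  have dis : (T `&` T')%fset = fset0.
    apply/fsetP => x; rewrite !inE; apply/negP => /andP[xT /imfsetP[t /=]].
    by rewrite mem_filter => /andP[htT _] xe; rewrite -xe xT in htT.
  have := fsubset_leq_card sub; have := cardfsUI T T'; rewrite dis cardfs0 addn0 => ->.
  rewrite -(ler_nat R) natrD cT'; apply: le_trans.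
  by rewrite mulrDl mul1r lerD2l ltW.
have growi n (T : {fset H}) :
    ((1 + eps) ^+ n * #|` T|%:R <= #|` iter n (dilate K1) T|%:R)%R.
  elim: n => [|n IHn]; first by rewrite mul1r.
  rewrite exprS -mulrA; apply: le_trans (grow _).
  by rewrite ler_wpM2l // addr_ge0 // ltW.
have bern n : (1 + n%:R * eps <= (1 + eps) ^+ n)%R.
  elim: n => [|n IHn]; first by rewrite mul0r addr0.
  rewrite exprS; have : ((1 + eps) * (1 + n%:R * eps) <= (1 + eps) * (1 + eps) ^+ n)%R.
    by rewrite ler_wpM2l // addr_ge0 // ltW.
  apply: le_trans; rewrite -natr1.
  have : (0 <= n%:R * eps * eps)%R by rewrite !mulr_ge0 // ltW.
  lra.
(* By Bernoulli's inequality, [n] iterations give a factor of at least [1 + n * eps], which exceeds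
   2. *)
pose n := Num.bound eps^-1.
have n_gt : (eps^-1 < n%:R)%R.
  by apply: le_lt_trans (archi_boundP _); rewrite // invr_ge0 ltW.
apply: (@not_doubling (iter n (dilate K1) [fset 1])) => T.
have -> : dilate (iter n (dilate K1) [fset 1]) T = iter n (dilate K1) T.
  by apply/fsetP => x; apply/dilateP/iter_dilateP.
rewrite -(ler_nat R) natrM; apply: le_trans (growi n T).
apply: ler_wpM2r => //; apply: le_trans (bern n).
rewrite -div1r ltr_pdivrMr // in n_gt; lra.
Qed.

End Folner.

Lemma amenable_folner (R : realType) (H : groupType) (K : seq H) (eps : R) :
  amenable R H -> (0 < eps)%R -> exists T : seq H,
  [/\ T <> [::], uniq T & {in K, forall h,
    (count (fun t => (h * t)%g \notin T) T)%:R <= eps * (size T)%:R}]%R.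
Proof. by case=> mu [mu0 muT muU muM]; exact: (mean_folner mu0 muT muU muM). Qed.

(** * Random orderings *)

Section Rare.
Variable R : realType.

(** Uniform probability at most [eps], written without division so that [X] may be empty. *)
Definition rare (X : finType) (eps : R) (P : pred X) : Prop :=
  (#|P|%:R <= eps * #|X|%:R)%R.

Lemma rareS (X : finType) (eps : R) (P Q : pred X) :
  subpred P Q -> rare eps Q -> rare eps P.
Proof.
move=> PQ; apply: le_trans; rewrite ler_nat; apply: subset_leq_card.
by apply/fintype.subsetP => x; exact: PQ.
Qed.

Lemma rare_le (X : finType) (eps del : R) (P : pred X) :
  (eps <= del)%R -> rare eps P -> rare del P.
Proof. by move=> le_ed rP; apply: le_trans rP _; rewrite ler_wpM2r. Qed.

Lemma rareU (X : finType) (eps del : R) (P Q : pred X) :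
  rare eps P -> rare del Q -> rare (eps + del)%R (predU P Q).
Proof.
move=> rP rQ; rewrite /rare mulrDl; apply: le_trans (lerD rP rQ).
by rewrite -natrD ler_nat -cardUI leq_addr.
Qed.

Lemma rare0 (X : finType) (eps : R) (P : pred X) : (0 <= eps)%R ->
  (forall x, ~~ P x) -> rare eps P.
Proof. by move=> e0 P0; rewrite /rare eq_card0 ?mulr_ge0 // => x; apply/negbTE/P0. Qed.

Lemma rare_inj (X : finType) (eps : R) (P : pred X) (f : X -> X) :
  injective f -> rare eps P -> rare eps (preim f P).
Proof.
move=> finj; apply: le_trans; rewrite ler_nat -(fintype.card_image finj).
apply: subset_leq_card; apply/fintype.subsetP => _ /fintype.imageP[x Px ->].
exact: Px.
Qed.

Lemma rare_fst (X Y : finType) (eps : R) (P : pred X) :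
  rare eps P -> rare eps [pred z : X * Y | P z.1].
Proof.
rewrite /rare => rP; rewrite card_prod natrM mulrA.
have -> : #|[pred z : X * Y | P z.1]| = (#|P| * #|Y|)%N.
  transitivity #|[predX P & @predT Y]|; last exact: fintype.cardX.
  by apply: eq_card => -[x y]; rewrite !inE andbT.
by rewrite natrM ler_wpM2r.
Qed.

Lemma rare_fiber (X Y : finType) (eps : R) (P : pred (X * Y)) :
  (forall x, rare eps [pred y | P (x, y)]) -> rare eps P.
Proof.
move=> rP; rewrite /rare card_prod natrM.
have -> : #|P| = \sum_x #|[pred y | P (x, y)]|.
  rewrite -sum1_card (eq_bigl (fun z => predT z.1 && P (z.1, z.2))); last by case.
  rewrite -(pair_big_dep predT (fun x y => P (x, y)) (fun _ _ => 1%N)) /=.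
  by apply: eq_bigr => x _; rewrite sum1_card.
rewrite natr_sum mulrCA mulr_natl -sumr_const; apply: ler_sum => x _; exact: rP.
Qed.

Lemma rare_has (X : finType) (I : Type) (eps : R) (s : seq I) (P : I -> pred X) :
  (forall i, rare eps (P i)) ->
  rare (eps *+ size s)%R [pred x | has (fun i => P i x) s].
Proof.
move=> rP; elim: s => [|i s IHs] /=; first exact: rare0.
by rewrite mulrS; apply: rareS (rareU (rP i) IHs) => x.
Qed.

End Rare.

(** The permutation [w] orders [A] by the rank of [w c]. The point [a] only witnesses that [U] is
    nonempty. *)
Definition argmin (A : finType) (w : {perm A}) (U : {set A}) (a : A) : A :=
  [arg min_(c < a in U) (enum_rank (w c) : nat)].

Section MinHash.
Variables (R : realType) (A : finType).
Implicit Types (U V D : {set A}) (w : {perm A}).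

Lemma argmin_in w U a : a \in U -> argmin w U a \in U.
Proof. by move=> aU; rewrite /argmin; case: arg_minnP. Qed.

Lemma argminP w U a b : a \in U -> b \in U ->
  (forall c, c \in U -> enum_rank (w b) <= enum_rank (w c)) -> argmin w U a = b.
Proof.
move=> aU bU minb; rewrite /argmin; case: arg_minnP => // c cU minc.
apply: (@perm_inj _ w); apply: enum_rank_inj; apply: val_inj; apply/eqP.
by rewrite /= eqn_leq minc // minb.
Qed.

Lemma argmin_le w U a c : a \in U -> c \in U ->
  enum_rank (w (argmin w U a)) <= enum_rank (w c).
Proof. by move=> aU; rewrite /argmin; case: arg_minnP => // b _; exact. Qed.

Lemma argmin_sub w U V a b : a \in U -> b \in V -> U \subset V ->
  argmin w V b \in U -> argmin w U a = argmin w V b.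
Proof.
move=> aU bV UV mU; apply: argminP => // c /(fintype.subsetP UV).
exact: argmin_le.
Qed.

(** Composing orderings with the transposition of two points of [U] exchanges their roles, so all
    points of [U] are equally often least. *)
Lemma card_argmin_eq U a u v : a \in U -> u \in U -> v \in U ->
  #|[pred w | argmin w U a == u]| = #|[pred w | argmin w U a == v]|.
Proof.
suff le x y : a \in U -> x \in U -> y \in U ->
    #|[pred w | argmin w U a == x]| <= #|[pred w | argmin w U a == y]|.
  by move=> aU uU vU; apply/eqP; rewrite eqn_leq !le.
move=> aU xU yU; have tU c : c \in U -> tperm x y c \in U by case: tpermP => [_|_|].
rewrite -(fintype.card_image (@mulgI _ (tperm x y))).
apply: subset_leq_card; apply/fintype.subsetP => _ /fintype.imageP[w /eqP wx ->].
rewrite inE; apply/eqP; apply: argminP => // c cU.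
rewrite !permM tpermR -[X in w X]wx; apply: argmin_le => //; exact: tU.
Qed.

Lemma card_argmin_in U D a : a \in U -> D \subset U ->
  (#|[pred w | argmin w U a \in D]| * #|U| = #|D| * #|{perm A}|)%N.
Proof.
move=> aU DU.
have card_in (E : {set A}) : E \subset U ->
    #|[pred w | argmin w U a \in E]| = (#|E| * #|[pred w | argmin w U a == a]|)%N.
  move=> EU; rewrite -[LHS]sum1_card.
  rewrite (partition_big (fun w : {perm A} => argmin w U a) (fun x => x \in E)) //=.
  rewrite -sum_nat_const; apply: eq_bigr => x xE.
  rewrite (card_argmin_eq aU aU (fintype.subsetP EU _ xE)) -sum1_card.
  by apply: eq_bigl => w /=; rewrite !inE; case: eqP => [->|]; rewrite ?xE ?andbF.
rewrite card_in // -mulnA; congr (_ * _)%N; rewrite mulnC -card_in //.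
by apply: eq_card => w; rewrite !inE argmin_in.
Qed.

(** If the least point of the union lies in both sets, it is the least point of each. So the minima
    differ only when that point, uniform in the union, falls in the symmetric difference. *)
Lemma minhash (eps : R) U V a b : a \in U -> b \in V ->
  (#|U :\: V|%:R + #|V :\: U|%:R <= eps * #|U|%:R)%R ->
  rare eps [pred w | argmin w U a != argmin w V b].
Proof.
move=> aU bV small; pose W := U :|: V; pose D := (U :\: V) :|: (V :\: U).
have aW : a \in W by rewrite inE aU.
have DW : D \subset W by apply/fintype.subsetP => x; rewrite !inE; case: (x \in U); case: (x \in V).
have U0 : (0 < #|U|)%N by apply/card_gt0P; exists a.
have W0 : (0 < #|W|)%N by apply/card_gt0P; exists a.
have eps0 : (0 <= eps)%R.
  by rewrite -(pmulr_lge0 _ (_ : 0 < #|U|%:R)%R) ?ltr0n //; apply: le_trans small; rewrite addr_ge0.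
have : rare eps [pred w | argmin w W a \in D].
  rewrite /rare -(ler_pM2r (_ : 0 < #|W|%:R)%R) ?ltr0n // -natrM card_argmin_in //.
  rewrite natrM mulrAC ler_wpM2r //.
  apply: (@le_trans _ _ (eps * #|U|%:R)%R); last first.
    by rewrite ler_wpM2l // ler_nat subset_leq_card // finset.subsetUl.
  apply: le_trans small; rewrite -natrD ler_nat.
  by rewrite /D cardsU leq_subr.
apply: rareS => w /=; rewrite !inE; apply: contraNT.
have := argmin_in w aW; set m := argmin w W a => mW.
move=> mD; have [mU mV] : m \in U /\ m \in V.
  by move: mW mD; rewrite !inE; case: (m \in U); case: (m \in V).
rewrite (argmin_sub aU aW) ?finset.subsetUl //.
by rewrite (argmin_sub bV aW) ?finset.subsetUr.
Qed.

End MinHash.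

(** * Repairing approximate actions *)

Section Complement.
Variable X : finType.
Implicit Types (D E : {set X}).

(* For sets [D], [E] of the same size, the bijection between their complements
   that preserves ranks: swapping [D] and [E] inverts it. *)
Definition compl_bij D E (a : X) : X :=
  nth a (enum (~: E)%SET) (index a (enum (~: D)%SET)).

Lemma compl_bijP D E a : #|D| = #|E| -> a \notin D ->
  compl_bij D E a \notin E /\ compl_bij E D (compl_bij D E a) = a.
Proof.
move=> DE aD; have aD' : a \in enum (~: D)%SET by rewrite mem_enum inE.
have szE : size (enum (~: D)%SET) = size (enum (~: E)%SET).
  by rewrite -!cardE; have := cardsC D; have := cardsC E; lia.
have lt : index a (enum (~: D)%SET) < size (enum (~: E)%SET).
  by rewrite -szE index_mem.
split; first by have := mem_nth a lt; rewrite mem_enum inE.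
rewrite /compl_bij index_uniq ?enum_uniq //.
by rewrite (set_nth_default a) ?nth_index // szE.
Qed.

Lemma perm_extend D (f : X -> X) : {in D &, injective f} ->
  exists s : {perm X}, {in D, s =1 f}.
Proof.
move=> finj; pose E := [set f x | x in D]%SET.
have DE : #|D| = #|E| by rewrite card_in_imset.
pose g a := if a \in D then f a else compl_bij D E a.
have ginj : injective g.
  move=> a b; rewrite /g; case: ifPn => aD; case: ifPn => bD.
  - exact: finj.
  - by have [nE _] := compl_bijP DE bD => e; rewrite -e imset_f in nE.
  - by have [nE _] := compl_bijP DE aD => e; rewrite e imset_f in nE.
  - by move=> e; have [_ <-] := compl_bijP DE aD; have [_ {1}<-] := compl_bijP DE bD; rewrite e.
by exists (perm ginj) => a aD; rewrite permE /g aD.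
Qed.

End Complement.

(** Freeness and multiplicativity hold only up to rare points, and nothing exact is asked at [1] or
    for inverses; [repair] restores the exact conditions. *)
Definition weakly_sofic (R : realType) (G : groupType) : Prop :=
  forall (eps : R) (F : seq G), (0 < eps)%R ->
  exists (A : finType) (phi : G -> {perm A}), [/\ (0 < #|A|)%N,
    {in F &, forall g h, rare eps [pred a | phi (g * h) a != phi h (phi g a)]}
  & {in F, forall g, g <> 1 -> rare eps [pred a | phi g a == a]}].

Section Repair.
Variables (G : groupType) (A : finType) (phi : G -> {perm A}).

(** The points where [phi g] may be kept: it moves them and [phi g^-1] undoes it. It maps this set
    onto the one for [g^-1]. *)
Definition inverse_support (g : G) : {set A} :=
  [set a | (phi g a != a) && (phi g^-1 (phi g a) == a)]%SET.

Lemma phi_inverse_support g a :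
  a \in inverse_support g -> phi g a \in inverse_support g^-1.
Proof.
by rewrite !inE => /andP[ga /eqP Vga]; rewrite Vga invgK eq_sym ga eqxx.
Qed.

Lemma card_inverse_support g : #|inverse_support g| = #|inverse_support g^-1|.
Proof.
suff le h : #|inverse_support h| <= #|inverse_support h^-1|.
  by apply/eqP; rewrite eqn_leq le -{2}[g]invgK le.
rewrite -(card_imset _ (@perm_inj _ (phi h))); apply: subset_leq_card.
by apply/fintype.subsetP => _ /imsetP[a ah ->]; exact: phi_inverse_support.
Qed.

(* Off [inverse_support g] the two sheets are exchanged, so no point is fixed. *)
Definition repair_fun (g : G) (z : A * bool) : A * bool :=
  if g == 1 then z else if z.1 \in inverse_support g then (phi g z.1, z.2)
  else (compl_bij (inverse_support g) (inverse_support g^-1) z.1, ~~ z.2).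

Lemma repair_funK g : cancel (repair_fun g) (repair_fun g^-1).
Proof.
case=> a b; rewrite /repair_fun invg_eq1; case: eqP => // _ /=.
have [aE|aE] := boolP (a \in inverse_support g) => /=.
  rewrite phi_inverse_support //.
  by move: aE; rewrite inE => /andP[_ /eqP ->].
have [nE cK] := compl_bijP (card_inverse_support g) aE.
by rewrite (negPf nE) invgK cK negbK.
Qed.

Definition repair (g : G) : {perm A * bool} := perm (can_inj (repair_funK g)).

Lemma repairE g a b : g <> 1 -> a \in inverse_support g ->
  repair g (a, b) = (phi g a, b).
Proof. by move=> /eqP g1 aE; rewrite permE /repair_fun /= aE (negPf g1). Qed.

Lemma repair1 : repair 1 = 1.
Proof. by apply/permP => z; rewrite permE perm1 /repair_fun eqxx. Qed.

Lemma repairV g : (repair g)^-1 = repair g^-1.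
Proof.
apply/permP => z; apply: (@perm_inj _ (repair g)).
by rewrite permKV ![in RHS]permE -{1}[g]invgK repair_funK.
Qed.

Lemma repair_free g z : g <> 1 -> repair g z <> z.
Proof.
case: z => a b /eqP g1; rewrite permE /repair_fun (negPf g1) /=.
case: ifPn => [|_ [_]]; last by case: b.
by rewrite inE => /andP[/eqP ga _] [].
Qed.

End Repair.

Lemma weakly_sofic_sofic (R : realType) (G : groupType) :
  weakly_sofic R G -> sofic R G.
Proof.
move=> ws eps F0 /andP[eps0 _] /finite_seqP[F ->].
pose F1 := F ++ [seq g * h | g <- F, h <- F].
pose F2 := 1 :: F1 ++ [seq g^-1 | g <- F1].
(* The repairs of [g], [h] and [g * h] cost [3 e] each, and the defect of multiplicativity costs
   [e]. *)
pose e := (eps / 10%:R)%R.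
have e0 : (0 < e)%R by rewrite divr_gt0.
have [A [phi [A0 phiM phi_free]]] := ws e F2 e0.
exists (A * bool)%type, (repair phi); split.
  by rewrite card_prod card_bool muln_gt0 A0.
have m1 : 1 \in F2 by rewrite inE eqxx.
(* Almost multiplicativity at [1 * 1] and injectivity of [phi 1] make [phi 1] almost the
   identity. *)
have r1 : rare e [pred a | phi 1 a != a].
  apply: rareS (phiM 1 1 m1 m1) => a /=; rewrite mulg1; apply: contra => /eqP e1.
  by rewrite {2}(perm_inj e1).
(* Three events are excluded: a fixed point of [phi g], a failure at the product [g * g^-1], and a
   point moved by [phi 1]. *)
have rV g : g \in F1 -> g <> 1 -> rare (3%:R * e)%R [pred a | a \notin inverse_support phi g].
  move=> gF g1; have gF2 : g \in F2 by rewrite inE mem_cat gF !orbT.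
  have gVF2 : g^-1 \in F2 by rewrite inE mem_cat map_f ?orbT.
  have -> : (3%:R * e = e + (e + e))%R by lra.
  apply: rareS (rareU (phi_free g gF2 g1) (rareU (phiM g g^-1 gF2 gVF2) r1)).
  move=> a /=; rewrite inE negb_and negbK mulgV; case: (phi g a == a) => //= Vga.
  have [e1|_] := eqVneq (phi 1 a) a; last by rewrite orbT.
  by rewrite orbF e1 eq_sym.
have rR g : g \in F1 ->
    rare (3%:R * e)%R [pred z | repair phi g z != (phi g z.1, z.2)].
  move=> gF; have [->|/eqP g1] := eqVneq g 1.
    apply: rare_le (_ : e <= _)%R _; first lra.
    apply: rareS (rare_fst _ r1) => -[a b] /=; rewrite repair1 perm1.
    by apply: contra => /eqP->.
  apply: rareS (rare_fst _ (rV g gF g1)) => -[a b] /=.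
  by apply: contra => aE; rewrite repairE.
split=> [||g _|g h gF hF].
- exact: repair1.
- exact: repairV.
- by move=> g1 a; apply: repair_free.
have gF1 : g \in F1 by rewrite mem_cat gF.
have hF1 : h \in F1 by rewrite mem_cat hF.
have ghF1 : g * h \in F1.
  by rewrite mem_cat; apply/orP; right; apply/allpairsP; exists (g, h).
have gF2 : g \in F2 by rewrite inE mem_cat gF1 !orbT.
have hF2 : h \in F2 by rewrite inE mem_cat hF1 !orbT.
pose f (z : A * bool) := (phi g z.1, z.2).
have finj : injective f by move=> [a b] [a' b'] [/perm_inj-> ->].
rewrite /eps_similar.
have : rare (3%:R * e + (3%:R * e + (3%:R * e + e)))%R
  [predU [pred z | repair phi (g * h) z != (phi (g * h) z.1, z.2)]
     & [predU [pred z | repair phi g z != f z]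
     & [predU preim f [pred z | repair phi h z != (phi h z.1, z.2)]
     & [pred z : A * bool | phi (g * h) z.1 != phi h (phi g z.1)]]]].
  apply: rareU (rR _ ghF1) _; apply: rareU (rR _ gF1) _.
  apply: rareU (rare_inj finj (rR _ hF1)) _.
  exact: (rare_fst _ (phiM g h gF2 hF2)).
have -> : (3%:R * e + (3%:R * e + (3%:R * e + e)) = eps)%R by rewrite /e; lra.
rewrite /rare; apply: le_trans; rewrite ler_nat subset_leq_card //.
apply/fintype.subsetP => z; rewrite !inE permM; apply: contraNT.
rewrite !negb_or !negbK => /and4P[/eqP-> /eqP-> /eqP-> /eqP-> /=].
by [].
Qed.

(** * Finite approximations of free groups *)

Section FreeApprox.

Definition signed (Q : groupType) (q : Q) (b : bool) : Q := if b then q^-1 else q.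

Definition no_cancel (S : eqType) : rel (S * bool) :=
  fun l l' => ~~ ((l.1 == l'.1) && (l.2 != l'.2)).

Definition word_prod (S : Type) (Q : groupType) (t : S -> Q) (w : seq (S * bool)) : Q :=
  \prod_(l <- w) signed (t l.1) l.2.

Lemma word_prod_cat (S : Type) (Q : groupType) (t : S -> Q) u v :
  word_prod t (u ++ v) = word_prod t u * word_prod t v.
Proof. exact: big_cat. Qed.

Lemma word_prod_cons (S : Type) (Q : groupType) (t : S -> Q) l v :
  word_prod t (l :: v) = signed (t l.1) l.2 * word_prod t v.
Proof. exact: big_cons. Qed.

Lemma word_prod1 (S : Type) (Q : groupType) (t : S -> Q) l :
  word_prod t [:: l] = signed (t l.1) l.2.
Proof. exact: big_seq1. Qed.

(* Letter number [i] of [w] is made to send [i] to [i.+1]; for each generator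
   these requirements form an injective partial map because [w] is reduced. *)
Lemma reduced_word_moves (S : finType) (n : nat) (w : seq (S * bool)) :
  size w <= n -> sorted (@no_cancel S) w ->
  exists t : S -> {perm 'I_n.+1}, word_prod t w ord0 = inord (size w).
Proof.
case E: w => [|l0 w0]; first exists (fun=> 1).
  by rewrite /word_prod big_nil perm1; apply/val_inj; rewrite /= inordK.
rewrite -{}E => szw /(sortedP l0) red {w0}.
(* Letter [i] equal to [s] asks [s] to send [i] to [i + 1]; letter [i - 1] equal to the inverse of
   [s] asks [s] to send [i] to [i - 1]. *)
pose fwd s i := (i < size w) && (nth l0 w i == (s, false)).
pose bwd s i := (0 < i <= size w) && (nth l0 w i.-1 == (s, true)).
pose D s := [set i : 'I_n.+1 | fwd s i || bwd s i]%SET.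
pose f s (i : 'I_n.+1) : 'I_n.+1 := if fwd s i then inord i.+1 else inord i.-1.
(* Conflicting values at one point, or equal values at two points, would need adjacent mutually
   inverse letters. *)
have excl s i : fwd s i -> bwd s i -> False.
  case: i => [|i]; first by rewrite /bwd ltnn.
  move=> /andP[lti /eqP ei] /andP[_ /= /eqP ei'].
  by have := red i lti; rewrite /no_cancel ei ei' /= eqxx.
have excl2 s i : fwd s i -> bwd s i.+2 -> False.
  move=> /andP[_ /eqP ei] /andP[/= lti /eqP ei'].
  by have := red i lti; rewrite /no_cancel ei ei' /= eqxx.
have finj s : {in D s &, injective (f s)}.
  move=> i j; rewrite !inE /f => iD jD.
  have := ltn_ord i; have := ltn_ord j => ltj lti.
  case: ifPn iD => [iF _|_ /= iB]; case: ifPn jD => [jF _|_ /= jB];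
    move/(congr1 val).
  - case/andP: (iF) => li _; case/andP: (jF) => lj _.
    by rewrite /= !inordK; [move=> [/ord_inj]| lia | lia].
  - case/andP: (iF) => li _; case/andP: (jB) => lj _.
    rewrite /= !inordK; [move=> e| lia | lia].
    by case: (excl2 s i iF); have -> : (i.+2 = j) by lia.
  - case/andP: (jF) => li _; case/andP: (iB) => lj _.
    rewrite /= !inordK; [move=> e| lia | lia].
    by case: (excl2 s j jF); have -> : (j.+2 = i) by lia.
  - case/andP: (iB) => li _; case/andP: (jB) => lj _.
    rewrite /= !inordK; [move=> e| lia | lia].
    by apply/val_inj => /=; lia.
have /choice[t tP] s : exists t : {perm 'I_n.+1}, {in D s, t =1 f s}.
  exact: perm_extend (finj s).
exists t; rewrite -{1}[w]take_size.
elim: {-2}(size w) (leqnn (size w)) => [|k IHk] ltk.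
  by rewrite take0 /word_prod big_nil perm1; apply/val_inj; rewrite /= inordK.
rewrite (take_nth l0) // -cats1 word_prod_cat permM IHk; last exact: ltnW.
rewrite word_prod1; case e: (nth l0 w k) => [s b] /=.
case: b e => e /=.
- have bk : bwd s k.+1 by rewrite /bwd ltk /= e.
  have kD : inord k.+1 \in D s by rewrite inE inordK ?bk ?orbT //; lia.
  apply: (@perm_inj _ (t s)); rewrite permKV tP // /f inordK; last lia.
  by case: ifPn => // /excl/(_ bk).
- have fk : fwd s k by rewrite /fwd ltk e /=.
  have kD : inord k \in D s by rewrite inE inordK ?fk //; lia.
  by rewrite tP // /f inordK ?fk //; lia.
Qed.

(** All assignments of permutations to the generators are used at once: the first coordinate of [X]
    stores one, and generators act through it on the second. Each short reduced word moves a point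
    over the assignment chosen for it. *)
Lemma free_group_approx (S : finType) (n : nat) :
  exists (Q : finGroupType) (t : S -> Q), forall w : seq (S * bool),
    w <> [::] -> size w <= n -> sorted (@no_cancel S) w -> word_prod t w <> 1.
Proof.
pose X := ({ffun S -> {perm 'I_n.+1}} * 'I_n.+1)%type.
pose f s (x : X) : X := (x.1, x.1 s x.2).
have finj s : injective (f s).
  by move=> [u i] [v j] [e]; rewrite /= e => /perm_inj ->.
exists {perm X}, (fun s => perm (finj s)) => w w0 szw red w1.
have prodE u v i : word_prod (fun s => perm (finj s)) v (u, i) = (u, word_prod u v i).
  elim: v i => [|[s b] v IHv] i; first by rewrite /word_prod !big_nil !perm1.
  rewrite !word_prod_cons !permM -IHv; congr (fun_of_perm _ _).
  case: b => /=; last by rewrite permE.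
  by apply: (@perm_inj _ (perm (finj s))); rewrite permKV permE /f /= permKV.
have [t tw] := reduced_word_moves szw red.
have := prodE (finfun t) w ord0; rewrite w1 perm1 => -[] /esym.
have -> : word_prod (finfun t) w = word_prod t w.
  by apply: eq_bigr => l _; rewrite ffunE.
rewrite tw => /(congr1 val); rewrite /= inordK ?ltnS //.
by case: w w0 {szw red w1 tw}.
Qed.

End FreeApprox.

(** * Quasi-actions on a common set *)

Section GoodAction.
Variable R : realType.

(** All failures of multiplicativity on [B] are collected in the single set [bad], while inverses
    and freeness remain exact. *)
Record good_action (G : groupType) (A : finType) (phi : G -> {perm A})
    (B : set G) (bad : pred A) : Prop := {
  good_actV : forall g, phi g^-1 = (phi g)^-1;
  good_act_free : forall g, B g -> g <> 1 -> forall a, phi g a <> a;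
  good_actM : forall g h a, B g -> B h -> ~~ bad a -> phi (g * h) a = phi h (phi g a) }.

(** Otherwise [g * h^-1] would be a nontrivial element of [B] fixing [a]. *)
Lemma good_action_inj (G : groupType) (A : finType) (phi : G -> {perm A})
    (B : set G) (bad : pred A) g h a :
  good_action phi B bad -> B g -> B h^-1 -> B (g * h^-1) -> ~~ bad a ->
  phi g a = phi h a -> g = h.
Proof.
move=> gA Bg Bh Bgh ga e; apply: contrapT => gh.
have gh1 : g * h^-1 <> 1 by move/(congr1 (mulg^~ h)); rewrite mulgKV mul1g.
apply: (good_act_free gA Bgh gh1 (a := a)).
by rewrite (good_actM gA) // e (good_actV gA) permK.
Qed.

Lemma sofic_good_action (G : groupType) (B : set G) (del : R) :
  sofic R G -> finite_set B -> (0 < del)%R ->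
  exists (A : finType) (phi : G -> {perm A}) (bad : pred A),
    [/\ (0 < #|A|)%N, good_action phi B bad & rare del bad].
Proof.
move=> sG fB del0; have /finite_seqP[s Bs] := fB.
pose pairs := [seq (g, h) | g <- s, h <- s].
(* Soficity needs [e < 1], and every pair gets an equal share of [del]; the successor avoids
   division by zero. *)
pose e := Num.min (1 / 2%:R)%R (del / (size pairs).+1%:R)%R.
have e01 : (0 < e < 1)%R.
  rewrite /e lt_min gt_min; apply/andP; split; last by apply/orP; left; lra.
  by apply/andP; split; [lra|rewrite divr_gt0].
have [A [phi [A0 sq]]] := sG e B e01 fB.
pose P p := [pred a | [&& p.1 \in s, p.2 \in s & phi (p.1 * p.2) a != phi p.2 (phi p.1 a)]].
exists A, phi, [pred a | has (fun p => P p a) pairs]; split=> //.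
- split; first by move=> g; rewrite (quasi_actionV sq).
    by move=> g Bg g1 a; apply: (quasi_action_free sq).
  move=> g h a; rewrite Bs /= => gs hs /hasPn /(_ (g, h)).
  have -> : (g, h) \in pairs by apply/allpairsP; exists (g, h).
  by rewrite gs hs /= negbK => /(_ isT) /eqP.
- have rP p : rare e (P p).
    have [/andP[p1 p2]|np] := boolP ((p.1 \in s) && (p.2 \in s)).
      have := quasi_actionM sq (g1 := p.1) (g2 := p.2); rewrite Bs /= => /(_ p1 p2).
      rewrite /eps_similar; apply: le_trans; rewrite ler_nat subset_leq_card //.
      by apply/fintype.subsetP => a; rewrite !inE permM => /and3P[].
    apply: rare0; first by case/andP: e01 => /ltW.
    by move=> a /=; rewrite andbA (negPf np).
  apply: rare_le (rare_has pairs rP); rewrite -mulr_natl.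
  apply: (@le_trans _ _ ((size pairs)%:R * (del / (size pairs).+1%:R)))%R.
    by rewrite ler_wpM2l // /e ge_min lexx orbT.
  by rewrite mulrCA ger_pMr // ler_pdivrMr ?ltr0n // mul1r ler_nat leqnSn.
Qed.

Lemma good_action_transport (G : groupType) (A : finType) (phi : G -> {perm A})
    (B : set G) (bad : pred A) (del : R) (k : nat) (X : finType) :
  good_action phi B bad -> rare del bad -> #|X| = (#|A| * k)%N ->
  exists (psi : G -> {perm X}) (bad' : pred X),
    good_action psi B bad' /\ rare del bad'.
Proof.
move=> gA rb cX.
have e : #|X| = #|{: A * 'I_k}| by rewrite card_prod card_ord.
pose f (x : X) : A * 'I_k := enum_val (cast_ord e (enum_rank x)).
pose g (y : A * 'I_k) : X := enum_val (cast_ord (esym e) (enum_rank y)).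
have fK : cancel f g by move=> x; rewrite /f /g enum_valK cast_ordK enum_rankK.
have gK : cancel g f by move=> x; rewrite /f /g enum_valK cast_ordKV enum_rankK.
pose F h x := g (phi h (f x).1, (f x).2).
have Finj h : injective (F h).
  move=> x y /(can_inj gK) [/perm_inj e1 e2]; apply: (can_inj fK).
  by rewrite [f x]surjective_pairing e1 e2 -surjective_pairing.
exists (fun h => perm (Finj h)), [pred x | bad (f x).1]; split.
  split.
  - move=> h; apply/permP => x; apply: (@perm_inj _ (perm (Finj h))).
    rewrite permKV !permE /F gK /= (good_actV gA) permKV.
    by rewrite -surjective_pairing fK.
  - move=> h Bh h1 x; rewrite permE => /(congr1 f); rewrite gK => /(congr1 fst).
    exact: (good_act_free gA).
  - move=> h h' x Bh Bh' bx; rewrite !permE /F gK /=.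
    by rewrite (good_actM gA).
rewrite /rare e; apply: le_trans (rare_fst 'I_k rb); rewrite ler_nat.
rewrite -(fintype.card_image (can_inj fK)); apply: subset_leq_card.
by apply/fintype.subsetP => _ /fintype.imageP[x bx ->].
Qed.

(** The product of the sizes over [vs] is a multiple of each size, so every action is copied onto a
    set of that size by [good_action_transport]. *)
Lemma common_good_action (V : choiceType) (G : V -> groupType) (vs : seq V)
    (B : forall v, set (G v)) (del : R) :
  (forall v, sofic R (G v)) -> (forall v, finite_set (B v)) -> (0 < del)%R ->
  exists (A : finType) (phi : forall v, G v -> {perm A}) (bad : V -> pred A),
    (0 < #|A|)%N /\ {in vs, forall v, good_action (phi v) (B v) (bad v) /\ rare del (bad v)}.
Proof.
move=> sG fB del0.
pose M v (A : finType) (phi : G v -> {perm A}) (bad : pred A) :=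
  [/\ (0 < #|A|)%N, good_action phi (B v) bad & rare del bad].
have /choice[Av AvP] v : exists A : finType, exists phi bad, @M v A phi bad.
  exact: sofic_good_action.
pose N := (\prod_(v <- vs) #|Av v|)%N.
have N0 : (0 < N)%N by apply: prodn_gt0 => v; have [phi [bad []]] := AvP v.
have ex v : exists psi : (G v -> {perm 'I_N}) * pred 'I_N,
    v \in vs -> good_action psi.1 (B v) psi.2 /\ rare del psi.2.
  have [vvs|_] := boolP (v \in vs); last by exists (fun=> 1, xpred0).
  have [phi [bad [_ gA rb]]] := AvP v.
  have [|psi [bad' gA']] := @good_action_transport _ _ _ _ _ _
    (\prod_(u <- rem v vs) #|Av u|)%N 'I_N gA rb.
    by rewrite card_ord /N (perm_big _ (perm_to_rem vvs)) big_cons.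
  by exists (psi, bad').
exists 'I_N, (fun v => (sval (cid (ex v))).1), (fun v => (sval (cid (ex v))).2).
by split=> [|v]; [rewrite card_ord|exact: (svalP (cid (ex v)))].
Qed.

End GoodAction.

Lemma multiplicative1 (G H : groupType) (f : {multiplicative G -> H}) : f 1 = 1.
Proof. by apply: (mulgI (f 1)); rewrite -gmulfM !mulg1. Qed.

Lemma multiplicativeV (G H : groupType) (f : {multiplicative G -> H}) x :
  f x^-1 = (f x)^-1.
Proof. by apply: (mulgI (f x)); rewrite -gmulfM !mulgV multiplicative1. Qed.

(** * Conjugating two actions of an amenable group *)

Definition act_fst (A W Y : Type) (f : A -> A) (x : (A * W) * Y) : (A * W) * Y :=
  ((f x.1.1, x.1.2), x.2).

Section Tiles.
Variables (A : finType) (H : groupType) (T : seq H).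
Implicit Types (al be : H -> {perm A}) (p : A * {perm A}).
Local Notation X := ((A * {perm A}) * (A * {perm A}))%type.
Implicit Types x : X.

Definition tile al a : {set A} := [set c in [seq al t a | t <- T]]%SET.

(* The ordering [p.2] of [A] selects a point of the tile of [p.1]. If [T] is
   almost invariant under left translation by [h], then [p.1] and its image under
   [h] have almost the same tile, hence the same centre for most orderings. *)
Definition center al p : A := argmin p.2 (tile al p.1) (al (head 1 T) p.1).

Definition tile_label al p : H :=
  nth 1 T (find (fun t => al t p.1 == center al p) T).

Definition shift al be x : X :=
  (x.1, ((be (tile_label al x.1))^-1 x.2.1, x.2.2)).
Definition unshift al be x : X :=
  (x.1, (be (tile_label al x.1) x.2.1, x.2.2)).

(* [shift al be] turns the action [al] on the first coordinate into the diagonal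
   action [(al, be)], which is symmetric in [al] and [be]. *)
Definition crossing al be x : X :=
  let y := shift al be x in unshift be al (y.2, y.1).

Lemma shiftK al be : cancel (shift al be) (unshift al be).
Proof. by case=> [p [b w]]; rewrite /shift /unshift /= permKV. Qed.

Lemma unshiftK al be : cancel (unshift al be) (shift al be).
Proof. by case=> [p [b w]]; rewrite /shift /unshift /= permK. Qed.

(** A crossing is shift, swap, unshift, so exchanging [al] and [be] reverses it. *)
Lemma crossingK al be : cancel (crossing al be) (crossing be al).
Proof.
move=> x; rewrite /crossing unshiftK /=.
by rewrite -[RHS](shiftK al be); congr unshift; case: (shift _ _ _).
Qed.

Hypotheses (T0 : T <> [::]) (uT : uniq T).

Lemma mem_tile al t a : t \in T -> al t a \in tile al a.
Proof. by move=> tT; rewrite inE map_f. Qed.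

Lemma head_in : head 1 T \in T.
Proof. by case: T T0 => // t s _; rewrite inE eqxx. Qed.

Lemma has_center al p : has (fun t => al t p.1 == center al p) T.
Proof.
have := argmin_in p.2 (mem_tile al p.1 head_in); rewrite -/(center al p).
by rewrite inE => /mapP[t tT ->]; apply/hasP; exists t.
Qed.

Lemma tile_label_in al p : tile_label al p \in T.
Proof. by rewrite mem_nth // -has_find has_center. Qed.

Lemma tile_labelE al p : al (tile_label al p) p.1 = center al p.
Proof. by apply/eqP; exact: (nth_find 1 (has_center al p)). Qed.

Section Translation.
Variables (R : realType) (al : H -> {perm A}) (B : set H) (bad : pred A) (h : H).
Hypothesis gA : good_action al B bad.

Definition tile_ok p := ~~ bad p.1 && (center al (al h p.1, p.2) == center al p).

Let U := T ++ [seq h * t | t <- T].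
(** Exactly the membership in [B] that makes [act_translate] and [act_inj] work for [T] and its
    translate by [h]. *)
Definition closed_at : Prop :=
  [/\ B h, {in T, forall t, B t} &
   {in U &, forall u v, [/\ B u, B v^-1 & B (u * v^-1)]}].
Hypothesis Bh : closed_at.

Lemma act_translate a t : ~~ bad a -> t \in T -> al t (al h a) = al (h * t) a.
Proof.
move=> ga tT; case: Bh => Bh1 BT _.
by rewrite (good_actM gA) //; apply: BT.
Qed.

Lemma act_inj a : ~~ bad a -> {in U &, injective (fun u => al u a)}.
Proof.
move=> ga u v uU vU; have [_ _ /(_ _ _ uU vU)[Bu Bv Buv]] := Bh.
exact: (good_action_inj gA Bu Bv Buv ga).
Qed.

(** Both elements carry [p.1] to the common centre, and at a good point distinct elements of [T] and
    [h T] have distinct effects. *)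
Lemma tile_label_act p : tile_ok p ->
  h * tile_label al (al h p.1, p.2) = tile_label al p.
Proof.
case/andP=> gp /eqP ec; apply: (act_inj gp).
- by rewrite mem_cat map_f ?orbT ?tile_label_in.
- by rewrite mem_cat tile_label_in.
by rewrite -act_translate ?tile_label_in // (tile_labelE al (al h p.1, p.2)) ec tile_labelE.
Qed.

(** At a good point [a], the tiles of [a] and [al h a] have the size of [T], and each misses at most
    [eps * size T] points of the other. So [minhash] applies with [2 eps] over the random
    ordering. *)
Lemma rare_not_tile_ok (eps del : R) : (0 <= eps)%R -> rare del bad ->
  ((count (fun t => (h * t)%g \notin T) T)%:R <= eps * (size T)%:R)%R ->
  rare (del + 2%:R * eps)%R [pred p | ~~ tile_ok p].
Proof.
move=> eps0 rbad fol.
suff rC : rare (2%:R * eps)%R [pred p | ~~ bad p.1 && (center al (al h p.1, p.2) != center al p)].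
  apply: rareS (rareU (rare_fst _ rbad) rC) => p /=.
  by rewrite negb_and negbK; case: (bad p.1).
apply: rare_fiber => a /=.
have [ba|ga] := boolP (bad a); first by apply: rare0; rewrite ?mulr_ge0.
have cV b : {in T &, injective (fun t => al t b)} -> #|tile al b| = size T.
  by move=> inj; rewrite cardsE (card_uniqP _) ?size_map ?map_inj_in_uniq.
have c1 : #|tile al a| = size T.
  by apply: cV => t t' tT tT'; apply: act_inj => //; rewrite mem_cat ?tT ?tT'.
have c2 : #|tile al (al h a)| = size T.
  apply: cV => t t' tT tT'; rewrite !act_translate // => e.
  by apply: (mulgI h); apply: (act_inj ga) => //; rewrite mem_cat map_f ?orbT.
apply: rareS (@minhash _ _ _ (tile al (al h a)) (tile al a) (al (head 1 T) (al h a))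
  (al (head 1 T) a) _ _ _) => //; try exact: mem_tile head_in.
rewrite c2.
have le : #|tile al (al h a) :\: tile al a| <= count (fun t => (h * t)%g \notin T) T.
  rewrite -size_filter; set s := [seq t <- T | _].
  rewrite -(size_map (fun t => al (h * t) a)); apply: leq_trans (card_size _).
  apply: subset_leq_card; apply/fintype.subsetP => c.
  rewrite finset.in_setD [_ \in tile _ (al h a)]inE => /andP[cn /mapP[t tT ec]].
  apply/mapP; exists t; last by rewrite -act_translate.
  rewrite mem_filter tT andbT; apply: contra cn => htT.
  by rewrite ec act_translate // mem_tile.
have -> : #|tile al a :\: tile al (al h a)| = #|tile al (al h a) :\: tile al a|.
  by rewrite !cardsD c1 c2 finset.setIC.
have {}le : (#|tile al (al h a) :\: tile al a|%:R <= eps * (size T)%:R :> R)%R.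
  by apply: le_trans fol; rewrite ler_nat.
lra.
Qed.

End Translation.

Section Crossing.
Variables (al be : H -> {perm A}) (B : set H) (B' : set H) (bada badb : pred A) (h : H).
Hypotheses (gA : good_action al B bada) (gB : good_action be B' badb).
Hypotheses (BA : closed_at B h) (BB : closed_at B' h).
Variable x : X.
Hypothesis okA : tile_ok al bada h x.1.
Hypothesis okB : tile_ok be badb h (crossing al be x).1.

(** By [okA] the label changes by [h], so after [shift] both factors move, by [al h] and [be h]. By
    [okB] the final [unshift] absorbs [al h] and leaves only [be h]. *)
Lemma crossing_act :
  crossing al be (act_fst (al h) x) = act_fst (be h) (crossing al be x).
Proof.
have labA := tile_label_act gA BA okA; have labB := tile_label_act gB BB okB.
case/andP: okA => ga _; case/andP: okB => gb _.
move: labA labB ga gb; case: x => [[a w] [b w']]; rewrite /crossing /act_fst /=.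
set t := tile_label al (a, w); set t' := tile_label al (al h a, w).
set b1 := (be t)^-1 b => labA.
have tT' : t' \in T by exact: tile_label_in.
have labT : tile_label be (be h b1, w') \in T by exact: tile_label_in.
move=> labB ga gb.
have -> : (be t')^-1 b = be h b1.
  apply: (@perm_inj _ (be t')); rewrite permKV (act_translate gB BB) //.
  by rewrite labA permKV.
by rewrite /unshift /= (act_translate gA BA) // labB.
Qed.

Lemma center_act : center al (act_fst (al h) x).1 = center al x.1.
Proof. by case/andP: okA => _ /eqP. Qed.

Lemma center_crossing_act :
  center be (crossing al be (act_fst (al h) x)).1 = center be (crossing al be x).1.
Proof. by rewrite crossing_act; case/andP: okB => _ /eqP. Qed.

End Crossing.

(** With labels [t] and [u], a common centre means that [g * theta t] and [theta u] agree at a good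
    point, hence are equal. *)
Lemma center_separated (G : groupType) (phi : G -> {perm A}) (theta : {multiplicative H -> G})
    (B : set G) (bad : pred A) (g : G) p :
  good_action phi B bad -> ~~ bad p.1 -> B g ->
  {in T &, forall t u, [/\ B (theta t), B (g * theta t), B (theta u)^-1 &
     B (g * theta t * (theta u)^-1)]} ->
  center (phi \o theta) (phi g p.1, p.2) = center (phi \o theta) p ->
  exists h, g = theta h.
Proof.
move=> gA gp Bg BT; rewrite -!tile_labelE /=.
set t := tile_label _ (phi g p.1, p.2); set u := tile_label _ p.
have [Bt Bgt Bu Bgtu] := BT t u (tile_label_in _ _) (tile_label_in _ _).
rewrite -(good_actM gA) // => /(good_action_inj gA Bgt Bu Bgtu gp) e.
by exists (u * t^-1); rewrite gmulfM multiplicativeV // -e mulgK.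
Qed.

End Tiles.

Lemma good_action_comp (G H : groupType) (A : finType) (phi : G -> {perm A})
    (theta : {multiplicative H -> G}) (B : set G) (bad : pred A) :
  injective theta -> good_action phi B bad ->
  good_action (phi \o theta) (theta @^-1` B)%classic bad.
Proof.
move=> tinj gA; split=> [h|h Bh h1|g h a Bg Bh ba] /=.
- by rewrite multiplicativeV (good_actV gA).
- apply: (good_act_free gA) => // e; apply: h1; apply: tinj.
  by rewrite e multiplicative1.
- by rewrite gmulfM (good_actM gA).
Qed.

(** * Models of a graph of groups *)

Section ReducedForms.
Variable GG : graph_of_groups.

Definition gtag : choiceType := {v : vertex GG & vgroup v}.
Definition syllable : Type := (dart GG * gtag)%type.

Definition gletter (x : gtag) : pi1_gen GG * bool := (inl x, false).
Definition dletter (d : dart GG) : pi1_gen GG * bool := (inr d.1, d.2).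

Definition syllable_word (l : seq syllable) : seq (pi1_gen GG * bool) :=
  flatten [seq [:: dletter s.1; gletter s.2] | s <- l].

Definition form_word (g : gtag) (l : seq syllable) : seq (pi1_gen GG * bool) :=
  gletter g :: syllable_word l.

Definition dart_rev (d : dart GG) : dart GG := (d.1, ~~ d.2).

Definition terminus_img (d : dart GG) (h : egroup d.1) : gtag :=
  if d.2 then Tagged (@vgroup GG) (theta1 d.1 h)
  else Tagged (@vgroup GG) (theta2 d.1 h).

(** Between a dart and its reverse, the vertex element must lie outside the edge group; adjacency of
    the darts is recorded separately in [path_form]. *)
Fixpoint reduced (l : seq syllable) : Prop :=
  if l is s :: l' then
    (if l' is s' :: _ then s'.1 = dart_rev s.1 ->
       tag s.2 = terminus s.1 /\ forall h, s.2 <> @terminus_img s.1 h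
     else True) /\ reduced l'
  else True.

End ReducedForms.

Section Model.
Variables (R : realType) (GG : graph_of_groups) (A : finType).
Variables (phi : forall v : vertex GG, vgroup v -> {perm A}).
Variables (es : seq (edge GG)) (T : forall e : edge GG, seq (egroup e)).

Definition src_act e : egroup e -> {perm A} := @phi (src e) \o theta1 e.
Definition tgt_act e : egroup e -> {perm A} := @phi (tgt e) \o theta2 e.

Local Notation X := ((A * {perm A}) * (A * {perm A}))%type.
Local Notation S := ('I_(size es).+1 * A * A)%type.

Definition traverse (d : dart GG) : X -> X :=
  if d.2 then crossing (T d.1) (@tgt_act d.1) (@src_act d.1)
  else crossing (T d.1) (@src_act d.1) (@tgt_act d.1).

Lemma traverseK d : cancel (traverse d) (traverse (dart_rev d)).
Proof. by case: d => e []; exact: crossingK. Qed.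

Lemma traverse_inj d : injective (traverse d).
Proof. exact: can_inj (traverseK d). Qed.

(* The label of a traversal records the edge and the centres of the tiles at both
   ends; it does not depend on the direction of the traversal. *)
Definition traverse_label (d : dart GG) (x : X) : S :=
  let y := traverse d x in
  let (s, t) := if d.2 then (y, x) else (x, y) in
  (inord (index d.1 es), center (T d.1) (@src_act d.1) s.1,
   center (T d.1) (@tgt_act d.1) t.1).

Lemma traverse_label_rev d x :
  traverse_label (dart_rev d) (traverse d x) = traverse_label d x.
Proof. by rewrite /traverse_label traverseK; case: d => e []. Qed.

Definition gact (g : gtag GG) (x : X) : X := act_fst (phi (tagged g)) x.

Lemma gact_inj g : injective (gact g).
Proof. by move=> [[a w] y] [[b w'] y'] [/perm_inj-> -> ->]. Qed.

Variables (Q : finGroupType) (tau : S -> Q).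
Local Notation Z := (X * Q)%type.

Definition model_fun (k : pi1_gen GG) (z : Z) : Z :=
  match k with
  | inl g => (gact g z.1, z.2)
  | inr e => (traverse (e, false) z.1, z.2 * tau (traverse_label (e, false) z.1))
  end.

Lemma model_inj k : injective (model_fun k).
Proof.
case: k => [g|e] [x q] [y r] E; move: (congr1 fst E) (congr1 snd E) => /=.
  by move=> /gact_inj -> ->.
by move=> /traverse_inj -> /mulIg ->.
Qed.

Definition model (k : pi1_gen GG) : {perm Z} := perm (@model_inj k).

(** An inverse stable letter traverses backwards and multiplies by the inverse of the same
    generator, because labels ignore the direction. *)
Lemma model_dletter (d : dart GG) z : signed (model (inr d.1)) d.2 z =
  (traverse d z.1, z.2 * signed (tau (traverse_label d z.1)) d.2).
Proof.
case: d => e [] /=; last by rewrite permE.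
apply: (@perm_inj _ (model (inr e))); rewrite permKV permE /=.
have -> : (e, false) = dart_rev (e, true) by [].
by rewrite traverseK traverse_label_rev mulgKV -surjective_pairing.
Qed.

Lemma model_gletter g z : signed (model (inl g)) false z = (gact g z.1, z.2).
Proof. by rewrite permE. Qed.

(** Evaluated at the image of [z], the leading inverse letter returns to [z]. Equivariance of the
    crossing then matches the [X]-coordinates, and unchanged centres give the same label and
    [Q]-coordinate. *)
Lemma model_edge_rel e (h : egroup e) (z : Z) :
  let cross := crossing (T e) (@src_act e) (@tgt_act e) in
  cross (act_fst (src_act h) z.1) = act_fst (tgt_act h) (cross z.1) ->
  center (T e) (@src_act e) (act_fst (src_act h) z.1).1 =
    center (T e) (@src_act e) z.1.1 ->
  center (T e) (@tgt_act e) (cross (act_fst (src_act h) z.1)).1 =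
    center (T e) (@tgt_act e) (cross z.1).1 ->
  word_prod model [:: stableV e; vletter (theta1 e h); stable e] (model (inr e) z) =
  word_prod model [:: vletter (theta2 e h)] (model (inr e) z).
Proof.
case: z => x q cross eX eA eB.
rewrite !word_prod_cons /word_prod big_nil !mulg1 !permM.
rewrite [signed _ true](_ : _ = (model (inr e))^-1) //.
rewrite permK !model_gletter (model_dletter (e, false)) permE.
have eL : traverse_label (e, false) (act_fst (src_act h) x) = traverse_label (e, false) x.
  by congr (_, _, _).
by congr pair; [exact: eX|congr (_ * tau _); exact: eL].
Qed.

Fixpoint run (l : seq (syllable GG)) (x : X) : X :=
  if l is s :: l' then run l' (gact s.2 (traverse s.1 x)) else x.

Fixpoint run_labels (l : seq (syllable GG)) (x : X) : seq (S * bool) :=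
  if l is s :: l' then
    (traverse_label s.1 x, s.1.2) :: run_labels l' (gact s.2 (traverse s.1 x))
  else [::].

Lemma size_run_labels l x : size (run_labels l x) = size l.
Proof. by elim: l x => //= s l IHl x; rewrite IHl. Qed.

Lemma model_syllable_word l x q : word_prod model (syllable_word l) (x, q) =
  (run l x, q * word_prod tau (run_labels l x)).
Proof.
elim: l x q => [|[d g] l IHl] x q; first by rewrite /word_prod !big_nil perm1 mulg1.
rewrite /syllable_word /= !word_prod_cons !permM model_dletter model_gletter IHl.
by rewrite mulgA.
Qed.

Variable bad : vertex GG -> pred A.

Fixpoint run_ok (l : seq (syllable GG)) (x : X) : bool :=
  if l is s :: l' then ~~ bad (terminus s.1) (traverse s.1 x).1.1
    && run_ok l' (gact s.2 (traverse s.1 x))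
  else true.

(** A union bound over the steps, each of which is a bijection of [X]. *)
Lemma rare_not_run_ok (del : R) l : (0 <= del)%R ->
  {in l, forall s : dart GG * gtag GG, rare del (bad (terminus s.1))} ->
  rare (del *+ size l)%R [pred x | ~~ run_ok l x].
Proof.
move=> del0; elim: l => [|s l IHl] rl /=; first exact: rare0.
rewrite mulrS; have rs := rl s; rewrite inE eqxx in rs.
have rs' := rare_fst (A * {perm A})%type (rare_fst {perm A} (rs isT)).
have rl' : rare (del *+ size l)%R [pred x | ~~ run_ok l x].
  by apply: IHl => s' s'l; apply: rl; rewrite inE s'l orbT.
have finj : injective (fun x => gact s.2 (traverse s.1 x)).
  by apply: inj_comp (@gact_inj _) (@traverse_inj _).
apply: rareS (rareU (rare_inj (@traverse_inj s.1) rs') (rare_inj finj rl')) => x /=.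
by rewrite negb_and negbK.
Qed.

(** Cancelling labels have the same edge, opposite directions and the same centres. The syllable
    between them then lies outside the edge group and so must have changed the centre at the middle
    vertex. *)
Lemma run_labels_reduced l x :
  (forall s : dart GG * gtag GG, s \in l -> s.1.1 \in es /\
    (forall y : X, ~~ bad (terminus s.1) y.1.1 ->
      tag s.2 = terminus s.1 -> (forall h, s.2 <> @terminus_img GG s.1 h) ->
      if s.1.2 then center (T s.1.1) (@src_act s.1.1) (gact s.2 y).1 <>
        center (T s.1.1) (@src_act s.1.1) y.1
      else center (T s.1.1) (@tgt_act s.1.1) (gact s.2 y).1 <>
        center (T s.1.1) (@tgt_act s.1.1) y.1)) ->
  reduced l -> run_ok l x -> sorted (@no_cancel _) (run_labels l x).
Proof.
elim: l x => [//|s [//|s' l] IHl] x sl [/= rs rl] /andP[oks okl].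
apply/andP; split; last first.
  by apply: (IHl _ _ rl okl) => t tl; apply: sl; rewrite inE tl orbT.
have [es1 sep] := sl s (mem_head _ _).
have es1' : s'.1.1 \in es.
  by have [] := sl s'; rewrite ?inE ?eqxx ?orbT.
apply/negP => /andP[/eqP /= eL nb].
have es' : s'.1 = dart_rev s.1.
  case: s s' es1 es1' eL nb {rs rl sl oks okl sep IHl} => [[e b] g] [[e' b'] g'] /= ee ee'.
  rewrite /traverse_label /= => eL nb.
  have : inord (index e es) = inord (index e' es) :> 'I_(size es).+1.
    by move: eL; case: ifP => _; case: ifP => _ [].
  move/(congr1 val); rewrite /= !inordK ?ltnS ?index_size // => ei.
  have -> : e' = e by rewrite -(nth_index e ee) ei nth_index.
  by congr pair; case: b b' nb {eL} => [] [].
have [tg nimg] := rs es'.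
have := sep _ oks tg nimg.
move: eL; rewrite es'; case: s {rs rl sl oks okl sep IHl es1 nb es' tg nimg} => [[e b] g].
rewrite /traverse_label /=.
by case: b => /= -[e1 e2]; [rewrite e1|rewrite e2].
Qed.

End Model.

(** * Finite sets of products in the vertex groups *)

Section Products.
Variables (GG : graph_of_groups) (L : seq (gtag GG)).
Local Open Scope classical_set_scope.

Definition gens (v : vertex GG) : set (vgroup v) :=
  [set g | [\/ g = 1, Tagged (@vgroup GG) g \in L | Tagged (@vgroup GG) g^-1 \in L]].
Arguments gens : clear implicits.

(** Four factors suffice: the longest elements needed are [u * v^-1] with [u], [v] in a tile set or
    its translate, each a product of two. *)
Definition prods (v : vertex GG) : set (vgroup v) :=
  [set p.1 * p.2 | p in [set p.1 * p.2 | p in gens v `*` gens v] `*`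
     [set p.1 * p.2 | p in gens v `*` gens v]].
Arguments prods : clear implicits.

Lemma finite_tagged (K : choiceType) (F : K -> choiceType) (s : seq {k : K & F k}) (k : K) :
  finite_set [set x : F k | Tagged F x \in s].
Proof.
apply: (@finite_preimage _ _ [set` s] (fun x : F k => Tagged F x)); last exact: finite_seq.
by move=> x y _ _ /eqP; rewrite eq_Tagged => /eqP.
Qed.

Lemma finite_gens v : finite_set (gens v).
Proof.
have -> : gens v = [set 1] `|` ([set g | Tagged (@vgroup GG) g \in L] `|`
    [set g^-1 | g in [set g | Tagged (@vgroup GG) g \in L]]).
  apply/seteqP; split=> g /=.
    case=> [->|gL|gL]; [by left|by right; left|right; right].
    by exists g^-1; rewrite ?invgK.
  case=> [->|[gL|[h hL <-]]]; [by constructor 1|by constructor 2|].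
  by constructor 3; rewrite invgK.
rewrite !finite_setU; split; first exact: finite_set1.
by split; [|apply: finite_image]; exact: finite_tagged.
Qed.

Lemma finite_prods v : finite_set (prods v).
Proof. by do ?[apply: finite_image|apply: finite_setX]; exact: finite_gens. Qed.

Lemma gens1 v : gens v 1. Proof. by constructor 1. Qed.

Lemma gensV v g : gens v g -> gens v g^-1.
Proof.
case=> [->|gL|gL]; first by rewrite invg1; constructor 1.
- by constructor 3; rewrite invgK.
- by constructor 2.
Qed.

Lemma gens_mem v (g : vgroup v) : Tagged (@vgroup GG) g \in L -> gens v g.
Proof. by constructor 2. Qed.

Lemma prods4 v a b c d : gens v a -> gens v b -> gens v c -> gens v d ->
  prods v (a * b * (c * d)).
Proof.
by move=> ga gb gc gd; exists (a * b, c * d) => //; split; [exists (a, b)|exists (c, d)].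
Qed.

Lemma prods3 v a b c : gens v a -> gens v b -> gens v c -> prods v (a * b * c).
Proof. by move=> ga gb gc; rewrite -[c]mulg1; apply: prods4 => //; exact: gens1. Qed.

Lemma prods2 v a b : gens v a -> gens v b -> prods v (a * b).
Proof. by move=> ga gb; rewrite -[a * b]mulg1; apply: prods3 => //; exact: gens1. Qed.

Lemma prods1 v a : gens v a -> prods v a.
Proof. by move=> ga; rewrite -[a]mulg1; apply: prods2 => //; exact: gens1. Qed.

Lemma closed_at_prods v (H : groupType) (theta : {multiplicative H -> vgroup v})
    (T : seq H) (h : H) :
  gens v (theta h) -> {in T, forall t, gens v (theta t)} ->
  closed_at T (theta @^-1` prods v) h.
Proof.
move=> gh gT.
have gU u : u \in T ++ [seq h * t | t <- T] ->
    exists a b, [/\ gens v a, gens v b & theta u = a * b].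
  rewrite mem_cat => /orP[uT|/mapP[t tT ->]].
    by exists 1, (theta u); rewrite mul1g; split=> //; [exact: gens1|exact: gT].
  by exists (theta h), (theta t); rewrite gmulfM; split=> //; exact: gT.
split; rewrite /preimage /=; first exact: prods1.
  by move=> t tT; apply/prods1/gT.
move=> u w /gU[a [b [ga gb eu]]] /gU[c [d [gc gd ew]]].
rewrite gmulfM !multiplicativeV eu ew invgM; split.
- exact: prods2.
- by apply: prods2; exact: gensV.
- by apply: prods4 => //; exact: gensV.
Qed.

End Products.

(** * Existence of models *)

Section Existence.
Variables (R : realType) (GG : graph_of_groups).
Hypothesis vertex_sofic : forall v : vertex GG, sofic R (@vgroup GG v).
Hypothesis edge_amenable : forall e : edge GG, amenable R (@egroup GG e).

(** The order of choices matters: first the Folner sets [T e], then the list [L] of elements to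
    control, then the common set [A], and last [Q], whose generators involve pairs of points of
    [A]. *)
Lemma models_exist (Lg : seq (gtag GG)) (Lh : seq {e : edge GG & egroup e})
    (W : seq (gtag GG * seq (syllable GG))) (eps : R) :
  (0 < eps)%R ->
  (forall p : gtag GG * seq (dart GG * gtag GG), p \in W ->
    reduced p.2 /\ (p.2 = [::] -> tagged p.1 <> 1)) ->
  exists (Z : finType) (m : pi1_gen GG -> {perm Z}), [/\ (0 < #|Z|)%N,
    forall v (g h : vgroup v), Tagged (@vgroup GG) g \in Lg ->
      Tagged (@vgroup GG) h \in Lg ->
      rare eps [pred z | word_prod m [:: vletter g; vletter h] z
        != word_prod m [:: vletter (g * h)] z],
    forall e (h : egroup e), Tagged (@egroup GG) h \in Lh ->
      rare eps [pred z | word_prod m [:: stableV e; vletter (theta1 e h); stable e] z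
        != word_prod m [:: vletter (theta2 e h)] z]
  & forall p : gtag GG * seq (dart GG * gtag GG), p \in W ->
      rare eps [pred z | word_prod m (form_word p.1 p.2) z == z]].
Proof.
move=> eps0 WP.
pose syls : seq (dart GG * gtag GG) := flatten [seq p.2 | p <- W].
pose n := (\max_(p <- W) size p.2)%N.
(* An edge relation costs two tile errors of [3 c] each; a form costs [c] per syllable, with at most
   [n] syllables. *)
pose c := (eps / (6 + n)%:R)%R.
have c0 : (0 < c)%R by rewrite divr_gt0.
have c6 : (c *+ 6 <= eps)%R.
  rewrite /c -mulr_natr mulrAC ler_pdivrMr ?ltr0n // ler_wpM2l ?ler_nat ?leq_addr //.
  exact: ltW.
have cn k : k <= n -> (c *+ k <= eps)%R.
  move=> kn; rewrite /c -mulr_natr mulrAC ler_pdivrMr ?ltr0n // ler_wpM2l ?ler_nat //.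
    exact: ltW.
  exact: leq_trans kn (leq_addl _ _).
have exK e : exists K : seq (egroup e),
    [set h | Tagged (@egroup GG) h \in Lh]%classic = [set` K]%classic.
  exact/finite_seqP/finite_tagged.
pose K e := sval (cid (exK e)); have KP e := svalP (cid (exK e)).
have exT e : exists T : seq (egroup e), [/\ T <> [::], uniq T & {in K e, forall h,
    (count (fun t => (h * t)%g \notin T) T)%:R <= c * (size T)%:R}]%R.
  exact: amenable_folner.
pose T e := sval (cid (exT e)).
have [T0 uT fT] : [/\ forall e, T e <> [::], forall e, uniq (T e) &
    forall e, {in K e, forall h,
      (count (fun t => (h * t)%g \notin T e) (T e))%:R <= c * (size (T e))%:R}]%R.
  by split=> e; have [] := svalP (cid (exT e)).
pose es := [seq tag h | h <- Lh] ++ [seq s.1.1 | s <- syls].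
pose img1 e (t : egroup e) : gtag GG := Tagged (@vgroup GG) (theta1 e t).
pose img2 e (t : egroup e) : gtag GG := Tagged (@vgroup GG) (theta2 e t).
pose L := Lg ++ [seq p.1 | p <- W] ++ [seq s.2 | s <- syls] ++
  [seq img1 (tag h) (tagged h) | h <- Lh] ++ [seq img2 (tag h) (tagged h) | h <- Lh] ++
  flatten [seq [seq img1 e t | t <- T e] | e <- es] ++
  flatten [seq [seq img2 e t | t <- T e] | e <- es].
pose vs := [seq tag g | g <- Lg] ++ [seq tag p.1 | p <- W] ++
  [seq src e | e <- es] ++ [seq tgt e | e <- es].
have [A [phi [bad [A0 good]]]] :=
  common_good_action vs vertex_sofic (finite_prods L) c0.
have [Q [tau tauP]] := free_group_approx ('I_(size es).+1 * A * A)%type n.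
pose m := model phi T tau.
have g1T e t : e \in es -> t \in T e -> gens L (theta1 e t).
  move=> ees tT; apply: gens_mem; rewrite /L !mem_cat; do 5![apply/orP; right].
  by apply/orP; left; apply/flatten_mapP; exists e => //; apply/mapP; exists t.
have g2T e t : e \in es -> t \in T e -> gens L (theta2 e t).
  move=> ees tT; apply: gens_mem; rewrite /L !mem_cat; do 6![apply/orP; right].
  by apply/flatten_mapP; exists e => //; apply/mapP; exists t.
have vs1 e : e \in es -> src e \in vs.
  by move=> ees; rewrite /vs !mem_cat map_f ?orbT.
have vs2 e : e \in es -> tgt e \in vs.
  by move=> ees; rewrite /vs !mem_cat map_f ?orbT.
exists ((A * {perm A}) * (A * {perm A}) * Q)%type, m; split.
- rewrite !card_prod !muln_gt0 A0 /= andbb.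
  by apply/andP; split; apply/card_gt0P; exists 1.
- move=> v g h gL hL.
  have vvs : v \in vs by rewrite /vs mem_cat (map_f (fun g : gtag GG => tag g) gL).
  have [gA rb] := good v vvs.
  have Bg : prods L g by apply/prods1/gens_mem; rewrite /L mem_cat gL.
  have Bh : prods L h by apply/prods1/gens_mem; rewrite /L mem_cat hL.
  apply: rareS (rare_le _ (rare_fst Q (rare_fst _ (rare_fst _ rb)))); last first.
    by apply: le_trans c6; rewrite mulrS lerDl mulrn_wge0 // ltW.
  move=> [[[a w] y] q] /=; apply: contraNT => nb.
  rewrite !word_prod_cons /word_prod big_nil !mulg1 permM !model_gletter.
  by rewrite /gact /act_fst /= (good_actM gA).
- move=> e h hL.
  have ees : e \in es by rewrite /es mem_cat (map_f (fun g : {e : edge GG & egroup e} => tag g) hL).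
  have [gA rA] := good _ (vs1 _ ees); have [gB rB] := good _ (vs2 _ ees).
  pose al := @src_act _ _ phi e; pose be := @tgt_act _ _ phi e.
  have {}gA : good_action al _ _ := good_action_comp (@theta1_inj GG e) gA.
  have {}gB : good_action be _ _ := good_action_comp (@theta2_inj GG e) gB.
  have h1 : gens L (theta1 e h).
    apply: gens_mem; rewrite /L !mem_cat; do 3![apply/orP; right].
    by apply/orP; left; apply/mapP; exists (Tagged (@egroup GG) h).
  have h2 : gens L (theta2 e h).
    apply: gens_mem; rewrite /L !mem_cat; do 4![apply/orP; right].
    by apply/orP; left; apply/mapP; exists (Tagged (@egroup GG) h).
  have cA := closed_at_prods h1 (fun t => @g1T e t ees).
  have cB := closed_at_prods h2 (fun t => @g2T e t ees).
  have hK : h \in K e.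
    by have /seteqP[sub _] := KP e; exact: sub.
  have okA := rare_not_tile_ok (T0 e) (uT e) gA cA (ltW c0) rA (fT e h hK).
  have okB := rare_not_tile_ok (T0 e) (uT e) gB cB (ltW c0) rB (fT e h hK).
  have rX : rare eps [pred x : (A * {perm A}) * (A * {perm A}) |
      ~~ tile_ok (T e) al (bad (src e)) h x.1 ||
      ~~ tile_ok (T e) be (bad (tgt e)) h (crossing (T e) al be x).1].
    apply: rare_le (rareU (rare_fst _ okA)
      (rare_inj (can_inj (crossingK (T e) al be)) (rare_fst _ okB))).
    by apply: le_trans c6; rewrite -mulr_natr; lra.
  (* The edge relation is checked at the image of a point under the stable letter, so the
     exceptional set is pulled back along its inverse. *)
  have := rare_inj (@perm_inj _ (m (inr e))^-1) (rare_fst Q rX).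
  apply: rareS => z; rewrite /preim !inE; apply: contraNT.
  rewrite negb_or !negbK => /andP[ok1 ok2]; rewrite -(permKV (m (inr e)) z).
  apply/eqP; apply: model_edge_rel.
  - exact (crossing_act (T0 e) gA gB cA cB ok1 ok2).
  - exact (center_act ok1).
  - exact (center_crossing_act (T0 e) gA gB cA cB ok1 ok2).
- case=> g0 l pW /=; have [red triv] := WP _ pW.
  have [l0|l0] := eqVneq l [::].
    apply: rare0 => [|z]; first exact: ltW.
    rewrite l0 /form_word /= word_prod1 model_gletter.
    have vvs : tag g0 \in vs.
      by rewrite /vs !mem_cat
        (map_f (fun p : gtag GG * seq (dart GG * gtag GG) => tag p.1) pW) orbT.
    have [gA _] := good _ vvs.
    apply/eqP => /(congr1 (fun z => z.1.1.1)) /=.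
    apply: (good_act_free gA _ (triv l0)); apply/prods1/gens_mem.
    rewrite /L !mem_cat; apply/orP; right; apply/orP; left.
    by apply/mapP; exists (g0, l) => //=; case: (g0).
  have szl : size l <= n.
    by rewrite /n (big_rem _ pW) /= leq_maxl.
  have syl s : s \in l -> s \in syls.
    by move=> sl; apply/flatten_mapP; exists (g0, l).
  have ses s : s \in l -> s.1.1 \in es.
    by move=> /syl sl; rewrite /es mem_cat; apply/orP; right; apply/mapP; exists s.
  have tvs s : s \in l -> terminus s.1 \in vs.
    by move=> /ses; case: s => [[e []] g] /=; [exact: vs1|exact: vs2].
  have rl : {in l, forall s : dart GG * gtag GG, rare c (bad (terminus s.1))}.
    by move=> s /tvs /good[].
  have rok := rare_not_run_ok phi T (ltW c0) rl.
  apply: rareS (rare_le (cn _ szl) (rare_fst Q (rare_inj (@gact_inj _ _ phi g0) rok))).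
  case=> [x q] /=; apply: contraL => ok.
  rewrite /form_word word_prod_cons permM model_gletter model_syllable_word.
  (* At a fixed point the label word would have product [1] in [Q], although it is nonempty, short
     and reduced. *)
  apply/eqP => /(congr1 snd) /= e1.
  apply: (tauP (run_labels phi es T l (gact phi g0 x))).
  + by case: (l) l0.
  + by rewrite size_run_labels.
  + apply: (run_labels_reduced _ red ok) => s sl; split; first exact: ses.
    case: s sl => [[e b] [v g]] sl /= y; have ees := ses _ sl.
    have Lgs : Tagged (@vgroup GG) g \in L.
      rewrite /L !mem_cat; do 2![apply/orP; right]; apply/orP; left.
      by apply/mapP; exists ((e, b), Tagged (@vgroup GG) g) => //; exact: syl.
    clear sl; case: b ees => /= ees nb tv; subst v => nimg eC.
    * have [h hg] := center_separated (T0 e) (good _ (vs1 _ ees)).1 nb (prods1 (gens_mem Lgs))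
        (fun t u tT uT' => And4 (prods1 (g1T e t ees tT)) (prods2 (gens_mem Lgs) (g1T e t ees tT))
          (prods1 (gensV (g1T e u ees uT')))
          (prods3 (gens_mem Lgs) (g1T e t ees tT) (gensV (g1T e u ees uT')))) eC.
      by apply: (nimg h); rewrite hg.
    * have [h hg] := center_separated (T0 e) (good _ (vs2 _ ees)).1 nb (prods1 (gens_mem Lgs))
        (fun t u tT uT' => And4 (prods1 (g2T e t ees tT)) (prods2 (gens_mem Lgs) (g2T e t ees tT))
          (prods1 (gensV (g2T e u ees uT')))
          (prods3 (gens_mem Lgs) (g2T e t ees tT) (gensV (g2T e u ees uT')))) eC.
      by apply: (nimg h); rewrite hg.
  + by apply: (mulgI q); rewrite e1 mulg1.
Qed.

End Existence.

(** * Words and reduced forms *)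

Section WordClasses.
Variables (X : choiceType) (rels : seq (X * bool) -> seq (X * bool) -> Prop).
Local Notation cls w := (wclass rels w : presented rels).

Lemma wclass_cat u v : wclass rels (u ++ v) = cls u * cls v.
Proof. by rewrite -pres_mulE. Qed.

Lemma wclass_cons l v : wclass rels (l :: v) = cls [:: l] * cls v.
Proof. by rewrite -wclass_cat. Qed.

Lemma wclass_nil : wclass rels [::] = 1 :> presented rels.
Proof. by []. Qed.

Lemma wclass_inv u : wclass rels (word_inv u) = (cls u)^-1.
Proof. by rewrite -pres_invE. Qed.

Lemma wclass_letter x b : wclass rels [:: (x, b)] = signed (cls [:: (x, false)]) b.
Proof. by case: b => //=; rewrite -wclass_inv. Qed.

Lemma wclass_rel u v : rels u v -> wclass rels u = wclass rels v.
Proof. by move=> uv; apply/wclassP; exact: word_eq_rel. Qed.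

End WordClasses.

Lemma word_eq_sub (X : choiceType) (r r' : seq (X * bool) -> seq (X * bool) -> Prop) u v :
  (forall a b, r a b -> r' a b) -> word_eq r u v -> word_eq r' u v.
Proof.
move=> rr'; elim=> {u v}.
- by move=> u; exact: word_eq_refl.
- by move=> u v _; exact: word_eq_sym.
- by move=> u v w _ uv _; exact: word_eq_trans.
- by move=> u u' v v' _ uu' _; exact: word_eq_cat.
- by move=> x b; exact: word_eq_cancel.
- by move=> u v /rr'; exact: word_eq_rel.
Qed.

Section Walks.
Variable GG : graph_of_groups.
Implicit Types (p q : seq (dart GG)) (u v w : vertex GG) (T : set (edge GG)).

Definition walk_word p : seq (pi1_gen GG * bool) := [seq dletter d | d <- p].

Lemma walk_cat u p q w :
  walk u (p ++ q) w <-> exists2 v, walk u p v & walk v q w.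
Proof.
elim: p u => [|d p IHp] u /=; first by split=> [|[v ->]]; [exists u|].
split=> [[du /IHp[v pv qv]]|[v [du pv] qv]]; first by exists v.
by split=> //; apply/IHp; exists v.
Qed.

Lemma origin_rev (d : dart GG) : origin (dart_rev d) = terminus d.
Proof. by case: d => e []. Qed.

Lemma terminus_rev (d : dart GG) : terminus (dart_rev d) = origin d.
Proof. by case: d => e []. Qed.

Lemma walk_in_cat T u p q w :
  walk_in T u (p ++ q) w <-> exists2 v, walk_in T u p v & walk_in T v q w.
Proof.
split=> [[/walk_cat[v pv qw] Tpq]|[v [pv Tp] [qw Tq]]].
  by exists v; split=> // d dp; apply: Tpq; rewrite mem_cat dp ?orbT.
split; first by apply/walk_cat; exists v.
by move=> d; rewrite mem_cat => /orP[/Tp|/Tq].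
Qed.

Lemma walk_in_cons T u d q w :
  walk_in T u (d :: q) w <-> [/\ origin d = u, T d.1 & walk_in T (terminus d) q w].
Proof.
split=> [[[du qw] Tdq]|[du Td [qw Tq]]].
  split=> //; first by apply: Tdq; rewrite inE eqxx.
  by split=> // e eq; apply: Tdq; rewrite inE eq orbT.
by split=> // e; rewrite inE => /orP[/eqP->|/Tq].
Qed.

Lemma walk_in_rev T u p v : walk_in T u p v ->
  walk_in T v (rev [seq dart_rev d | d <- p]) u.
Proof.
elim: p u => [|d p IHp] u; first by case=> /= ->.
move=> /walk_in_cons[du Td /IHp wp]; rewrite /= rev_cons -cats1.
apply/walk_in_cat; exists (terminus d) => //.
apply/walk_in_cons; split=> //=; first exact: origin_rev.
by split=> //=; rewrite terminus_rev.
Qed.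

Lemma walk_word_rev p : walk_word (rev [seq dart_rev d | d <- p]) = word_inv (walk_word p).
Proof. by rewrite /walk_word /word_inv map_rev -!map_comp. Qed.

Lemma not_uniq_map (D K : eqType) (f : D -> K) (p : seq D) : ~~ uniq (map f p) ->
  exists (p1 p2 p3 : seq D) (d1 d2 : D),
    p = p1 ++ d1 :: p2 ++ d2 :: p3 /\ f d1 = f d2.
Proof.
elim: p => //= d p IHp; rewrite negb_and negbK => /orP[/mapP[d2 d2p e]|/IHp].
  by case/splitPr: d2p => p2 p3; exists [::], p2, p3, d, d2.
by case=> p1 [p2 [p3 [d1 [d2 [-> e]]]]]; exists (d :: p1), p2, p3, d1, d2.
Qed.

(** Strong induction on the length. A repeated origin splits off a shorter closed walk; an edge used
    in both directions encloses a closed walk, after whose removal the two darts cancel. Without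
    repetitions the walk is empty by acyclicity. *)
Lemma closed_walk_trivial rels T u p : acyclic T -> walk_in T u p u ->
  wclass rels (walk_word p) = 1 :> presented rels.
Proof.
move=> acy; elim: {p}(size p).+1 {-2}p (ltnSn (size p)) u => // n IHn p ltpn u wp.
have wcat a b : wclass rels (walk_word (a ++ b)) =
    (wclass rels (walk_word a) : presented rels) * wclass rels (walk_word b).
  by rewrite /walk_word map_cat wclass_cat.
have [/andP[uf uo]|] := boolP (uniq (map fst p) && uniq (map (@origin GG) p)).
  by rewrite (acy _ _ wp uf uo).
rewrite negb_and => nu.
have {nu} [p1 [p2 [p3 [d1 [d2 [ep ed]]]]]] : exists p1 p2 p3 (d1 d2 : dart GG),
    p = p1 ++ d1 :: p2 ++ d2 :: p3 /\ (origin d1 = origin d2 \/ d2 = dart_rev d1).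
  case/orP: nu => /not_uniq_map[p1 [p2 [p3 [d1 [d2 [ep ed]]]]]];
    exists p1, p2, p3, d1, d2; split=> //; last by left.
  case: d1 d2 ed {ep} => e b [e' b'] /= <-.
  by case: b b' => [] []; [left|right|right|left].
move: wp ltpn; rewrite {p}ep => /walk_in_cat[v wp1 /walk_in_cons[d1v Td1]].
move=> /walk_in_cat[x wp2 /walk_in_cons[d2x Td2 wp3]].
rewrite size_cat /= size_cat /= => ltpn.
case: ed => ed.
- have c1 : walk_in T v (d1 :: p2) v.
    by apply/walk_in_cons; split=> //; rewrite -d1v ed d2x.
  have c2 : walk_in T u (p1 ++ d2 :: p3) u.
    by apply/walk_in_cat; exists v => //; apply/walk_in_cons; split; rewrite // -ed.
  rewrite -cat_cons wcat wcat (IHn _ _ _ c1); last by rewrite /=; lia.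
  by rewrite mul1g -wcat; apply: IHn c2; rewrite size_cat /=; lia.
- have c1 : walk_in T (terminus d1) p2 (terminus d1).
    by rewrite -{2}origin_rev -ed d2x.
  have c2 : walk_in T u (p1 ++ p3) u.
    by apply/walk_in_cat; exists v => //; rewrite -d1v -terminus_rev -ed.
  have wcons d q : wclass rels (walk_word (d :: q)) =
      (wclass rels (walk_word [:: d]) : presented rels) * wclass rels (walk_word q).
    exact: wcat [:: d] q.
  rewrite wcat (wcons d1) wcat (wcons d2) (IHn _ _ _ c1); last by lia.
  have -> : walk_word [:: d2] = word_inv (walk_word [:: d1]) by rewrite ed.
  rewrite wclass_inv mul1g mulVKg -wcat; apply: IHn c2.
  by rewrite size_cat; lia.
Qed.

End Walks.

Section Paths.
Variable GG : graph_of_groups.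
Local Notation letter := (pi1_gen GG * bool)%type.
(** Without tree relations this presents the path group, in which loops at a base vertex represent
    the fundamental group. *)
Local Notation free_rels := (@pi1_rels GG set0).

Definition letter_start (l : letter) : vertex GG :=
  match l.1 with inl g => tag g | inr e => origin (e, l.2) end.
Definition letter_end (l : letter) : vertex GG :=
  match l.1 with inl g => tag g | inr e => terminus (e, l.2) end.

Fixpoint path_word (u : vertex GG) (w : seq letter) (v : vertex GG) : Prop :=
  if w is l :: w' then letter_start l = u /\ path_word (letter_end l) w' v else u = v.

Lemma path_word_cat u w x w' v :
  path_word u w x -> path_word x w' v -> path_word u (w ++ w') v.
Proof. by elim: w u => [|l w IHw] u /=; [move=> ->|case=> -> /IHw h /h]. Qed.

Lemma path_walk_word u p v : walk u p v -> path_word u (walk_word p) v.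
Proof. by elim: p u => //= -[e b] p IHp u [du /IHp]. Qed.

Lemma letter_start_inv (x : pi1_gen GG) b : letter_start (x, ~~ b) = letter_end (x, b).
Proof. by case: x b => [g|e] []. Qed.

Lemma letter_end_inv (x : pi1_gen GG) b : letter_end (x, ~~ b) = letter_start (x, b).
Proof. by case: x b => [g|e] []. Qed.

Lemma path_word_inv u w v : path_word u w v -> path_word v (word_inv w) u.
Proof.
elim: w u => [|[x b] w IHw] u //=; case=> <- /IHw pw.
rewrite -cat1s word_inv_cat; apply: path_word_cat pw _.
by rewrite /word_inv /=; split; [exact: letter_start_inv|rewrite letter_end_inv].
Qed.

Section Loops.
Variables (T : set (edge GG)) (v0 : vertex GG) (P : vertex GG -> seq (dart GG)).
Hypothesis T_acyclic : acyclic T.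
Hypothesis PT : forall v, walk_in T v0 (P v) v.

(* The element of the fundamental group based at [v0] that represents a letter. *)
Definition loop_letter (l : letter) : seq letter :=
  walk_word (P (letter_start l)) ++ l :: word_inv (walk_word (P (letter_end l))).

Definition loop_word (w : seq letter) : seq letter := flatten [seq loop_letter l | l <- w].

Lemma loop_word_cat u v : loop_word (u ++ v) = loop_word u ++ loop_word v.
Proof. by rewrite /loop_word map_cat flatten_cat. Qed.

Lemma path_loop_word w : path_word v0 (loop_word w) v0.
Proof.
elim: w => [//|l w IHw]; apply: path_word_cat IHw.
apply: path_word_cat (path_walk_word (PT _).1) _; split=> //.
exact: path_word_inv (path_walk_word (PT _).1).
Qed.

Lemma loop_word_path rels u w v : path_word u w v ->
  wclass rels (loop_word w) = (wclass rels (walk_word (P u)) : presented rels) *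
    wclass rels w * (wclass rels (walk_word (P v)) : presented rels)^-1.
Proof.
elim: w u => [|l w IHw] u /=; first by move=> ->; rewrite wclass_nil mulg1 mulgV.
case=> <- /IHw e; rewrite -cat1s loop_word_cat wclass_cat e [in RHS]wclass_cat.
rewrite /loop_word /= cats0 /loop_letter wclass_cat wclass_cons wclass_inv.
by rewrite !mulgA mulgKV.
Qed.

Lemma loop_word_tree rels e : T e ->
  wclass rels (loop_word [:: stable e]) = 1 :> presented rels.
Proof.
move=> Te; rewrite (@loop_word_path _ (src e) _ (tgt e)) // -wclass_inv -walk_word_rev.
rewrite -!wclass_cat; pose p := P (src e) ++ (e, false) :: rev [seq dart_rev d | d <- P (tgt e)].
have -> : (walk_word (P (src e)) ++ [:: stable e]) ++
    walk_word (rev [seq dart_rev d | d <- P (tgt e)]) = walk_word p.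
  by rewrite /walk_word map_cat -catA.
apply: (closed_walk_trivial rels T_acyclic (u := v0)).
apply/walk_in_cat; exists (src e); first exact: PT.
by apply/walk_in_cons; split=> //; exact/walk_in_rev/PT.
Qed.

(** Vertex and edge relations have common end points and are merely conjugated by tree paths; a tree
    letter becomes a closed walk in the tree, trivial by free cancellation. *)
Lemma loop_word_eq u v : word_eq (@pi1_rels GG T) u v ->
  word_eq free_rels (loop_word u) (loop_word v).
Proof.
move=> uv; apply/wclassP; elim: uv => {u v} //.
- by move=> u v w _ -> _.
- by move=> u u' v v' _ e _ e'; rewrite !loop_word_cat !wclass_cat e e'.
- move=> x b; rewrite (@loop_word_path _ (letter_start (x, b)) _ (letter_start (x, b))).
    rewrite (_ : wclass _ [:: _; _] = 1) ?mulg1 ?mulgV //.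
    by apply/wclassP/word_eq_cancel.
  by split=> //; split; [exact: letter_start_inv|exact: letter_end_inv].
- move=> _ _ [v g h|e g|e Te].
  + rewrite !(@loop_word_path _ v _ v) //; congr (_ * _ * _).
    exact/wclass_rel/pi1_vertex.
  + rewrite !(@loop_word_path _ (tgt e) _ (tgt e)) //; congr (_ * _ * _).
    exact/wclass_rel/pi1_edge.
  + by rewrite loop_word_tree.
Qed.

Lemma tree_word_trivial p : {in p, forall d : edge GG * bool, T d.1} ->
  wclass (@pi1_rels GG T) (walk_word p) = 1 :> pi1 T.
Proof.
elim: p => // [[e b] p IHp] Tp; rewrite /walk_word /= wclass_cons.
rewrite (IHp _) ?mulg1 => [|d dp]; last by apply: Tp; rewrite inE dp orbT.
rewrite wclass_letter (_ : wclass _ _ = 1); first by case: b {Tp}; rewrite /= ?invg1.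
apply: wclass_rel; apply: pi1_tree.
exact: (Tp (e, b) (mem_head _ _)).
Qed.

(** Tree paths are trivial in [pi1 T], so passing to loops loses no information. *)
Lemma loop_word_pi1 w : wclass (@pi1_rels GG T) (loop_word w) = wclass (@pi1_rels GG T) w.
Proof.
elim: w => [//|l w IHw]; rewrite -cat1s loop_word_cat wclass_cat [in RHS]wclass_cat IHw.
congr (_ * _).
rewrite /loop_word /= cats0 /loop_letter wclass_cat wclass_cons wclass_inv.
by rewrite !tree_word_trivial ?invg1 ?mul1g ?mulg1 //; exact: (PT _).2.
Qed.

End Loops.

Local Notation cls w := (wclass free_rels w : presented free_rels).

Lemma vletterM v (g h : vgroup v) : cls [:: vletter g; vletter h] = cls [:: vletter (g * h)].
Proof. exact/wclass_rel/pi1_vertex. Qed.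

Lemma vletter1 v : cls [:: vletter (1 : vgroup v)] = 1.
Proof.
apply: (mulgI (cls [:: vletter (1 : vgroup v)])).
by rewrite -wclass_cat vletterM !mulg1.
Qed.

Lemma vletter_signed v (g : vgroup v) b :
  cls [:: (inl (Tagged (@vgroup GG) g), b)] = cls [:: vletter (signed g b)].
Proof.
case: b => //=; rewrite wclass_letter; apply: (mulgI (cls [:: vletter g])).
by rewrite mulgV -wclass_cat vletterM mulgV vletter1.
Qed.

Lemma pinch (d : dart GG) (h : egroup d.1) :
  cls [:: dletter d; gletter (terminus_img h); dletter (dart_rev d)] =
  cls [:: gletter (@terminus_img GG (dart_rev d) h)].
Proof.
case: d h => e [] /= h; first exact/wclass_rel/pi1_edge.
have cls3 a b c : cls [:: a; b; c] = cls [:: a] * cls [:: b] * cls [:: c].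
  by rewrite -!wclass_cat.
have e1 : cls [:: stableV e; vletter (theta1 e h); stable e] = cls [:: vletter (theta2 e h)].
  exact/wclass_rel/pi1_edge.
have sV : cls [:: stableV e] = (cls [:: stable e])^-1 by exact: wclass_letter.
transitivity (cls [:: stable e] * cls [:: vletter (theta2 e h)] * cls [:: stableV e]).
  exact: cls3.
by rewrite -e1 cls3 sV !mulgA mulgV mul1g mulgK.
Qed.

Lemma tag_terminus_img (d : dart GG) (h : egroup d.1) :
  tag (terminus_img h) = terminus d.
Proof. by case: d h => e []. Qed.

Lemma syllable_word_cons (d : dart GG) (g : gtag GG) l :
  syllable_word ((d, g) :: l) = [:: dletter d, gletter g & syllable_word l].
Proof. by []. Qed.

Lemma form_wordE (g : gtag GG) l :
  cls (form_word g l) = cls [:: gletter g] * cls (syllable_word l).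
Proof. exact: wclass_cons. Qed.

Fixpoint path_form (u : vertex GG) (l : seq (dart GG * gtag GG)) (v : vertex GG) : Prop :=
  if l is s :: l' then [/\ origin s.1 = u, tag s.2 = terminus s.1 &
    path_form (terminus s.1) l' v] else u = v.

(** Induction on the word: a vertex letter merges into the leading element, and an edge letter adds
    a syllable or undoes a pinch. *)
Lemma reduced_form u w v : path_word u w v ->
  exists (g : vgroup u) (l : seq (dart GG * gtag GG)),
    [/\ reduced l, path_form u l v &
     cls w = cls (form_word (Tagged (@vgroup GG) g) l)].
Proof.
elim: w u => [|[x b] w IHw] u /=.
  by exists 1, [::]; split=> //; exact: (esym (vletter1 u)).
case: x => [[u' a]|e]; rewrite /letter_start /letter_end /=.
  case=> eu /IHw[g [l [rl pl ew]]]; subst u'.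
  exists (signed a b * g), l; split=> //.
  rewrite wclass_cons ew !form_wordE mulgA vletter_signed; congr (_ * _).
  by rewrite -wclass_cat; exact: vletterM.
set d := (e, b) : dart GG; case=> du /IHw[g [l [rl pl ew]]].
(* A pinch arises when the next dart reverses [d] and [g] lies in the edge group. *)
have [[s [l' [h [el es eg]]]]|nopinch] := pselect (exists s l' (h : egroup d.1),
    [/\ l = s :: l', s.1 = dart_rev d & Tagged (@vgroup GG) g = terminus_img h]).
- move: rl pl ew; rewrite el eg => -[_ rl'] [_ ts pl'] ew.
  move: ts pl' ew; rewrite es terminus_rev du; case: s es {el} => s1 [u' k] /= es1.
  move=> eu'; subst u'; rewrite es1 => pl' ew.
  have [k0 ek0] : exists k0 : vgroup u, @terminus_img GG (dart_rev d) h = Tagged (@vgroup GG) k0.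
    have tu : tag (@terminus_img GG (dart_rev d) h) = u.
      by rewrite tag_terminus_img terminus_rev.
    by move: tu; case: (terminus_img _) => u' k0 /= eu; subst u'; exists k0.
  exists (k0 * k), l'; split=> //.
  rewrite wclass_cons ew form_wordE syllable_word_cons.
  have e4 c : cls [:: dletter d] * (cls [:: gletter (terminus_img h)] *
      cls (dletter (dart_rev d) :: c)) =
      cls [:: dletter d; gletter (terminus_img h); dletter (dart_rev d)] * cls c.
    by rewrite -!wclass_cat.
  apply: etrans (e4 _) _; rewrite pinch ek0 (wclass_cons _ _ (syllable_word l')).
  rewrite form_wordE mulgA; congr (_ * _).
  by rewrite -wclass_cat; exact: vletterM.
- exists 1, ((d, Tagged (@vgroup GG) g) :: l); split=> //.
  + split=> //; case: l rl pl ew nopinch => // s l _ _ _ nop es.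
    by split=> // h eg; apply: nop; exists s, l, h.
  + rewrite wclass_cons ew [RHS]form_wordE (_ : cls [:: gletter _] = 1) ?mul1g.
      by rewrite -wclass_cons.
    exact: vletter1.
Qed.

End Paths.

(** * Models and relations *)

Section Soundness.
Variables (R : realType) (GG : graph_of_groups).
Local Notation free_rels := (@pi1_rels GG set0).

Definition respects (Lg : seq (gtag GG)) (Lh : seq {e : edge GG & egroup e})
    (eps : R) (Z : finType) (m : pi1_gen GG -> {perm Z}) : Prop :=
  (forall v (g h : vgroup v), Tagged (@vgroup GG) g \in Lg ->
      Tagged (@vgroup GG) h \in Lg ->
      rare eps [pred z | word_prod m [:: vletter g; vletter h] z
        != word_prod m [:: vletter (g * h)] z]) /\
  (forall e (h : egroup e), Tagged (@egroup GG) h \in Lh ->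
      rare eps [pred z | word_prod m [:: stableV e; vletter (theta1 e h); stable e] z
        != word_prod m [:: vletter (theta2 e h)] z]).

(** Truth in all models that respect a finite part of the presentation well enough, a notion stable
    under finite conjunctions. *)
Definition eventually (P : forall Z : finType, (pi1_gen GG -> {perm Z}) -> Prop) : Prop :=
  exists Lg Lh (eps : R), (0 < eps)%R /\
    forall (Z : finType) (m : pi1_gen GG -> {perm Z}), respects Lg Lh eps m -> P Z m.

Lemma respects_sub Lg Lg' Lh Lh' (eps eps' : R) Z (m : pi1_gen GG -> {perm Z}) :
  {subset Lg' <= Lg} -> {subset Lh' <= Lh} -> (eps <= eps')%R ->
  respects Lg Lh eps m -> respects Lg' Lh' eps' m.
Proof.
move=> sg sh le_eps [mg mh]; split.
  by move=> v g h /sg gL /sg hL; apply: rare_le le_eps (mg v g h gL hL).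
by move=> e h /sh hL; apply: rare_le le_eps (mh e h hL).
Qed.

Lemma eventually_and P Q : eventually P -> eventually Q ->
  eventually (fun Z m => P Z m /\ Q Z m).
Proof.
case=> Lg [Lh [d [d0 evP]]] [Lg' [Lh' [d' [d'0 evQ]]]].
exists (Lg ++ Lg'), (Lh ++ Lh'), (Num.min d d'); split; first by rewrite lt_min d0.
move=> Z m rm; split; [apply: evP|apply: evQ]; apply: respects_sub rm => //;
  by [move=> x; rewrite mem_cat => ->; rewrite ?orbT|rewrite ge_min lexx ?orbT].
Qed.

Lemma eventually_all (I : eqType) (s : seq I)
    (P : I -> forall Z : finType, (pi1_gen GG -> {perm Z}) -> Prop) :
  {in s, forall i, eventually (P i)} ->
  eventually (fun Z m => {in s, forall i, P i Z m}).
Proof.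
elim: s => [|i s IHs] evP; first by exists [::], [::], 1%R; split.
have evs : eventually (fun Z m => {in s, forall i, P i Z m}).
  by apply: IHs => j js; apply: evP; rewrite inE js orbT.
have [Lg [Lh [d [d0 ev]]]] := eventually_and (evP i (mem_head _ _)) evs.
exists Lg, Lh, d; split=> // Z m /ev[Pi Ps] j.
by rewrite inE => /orP[/eqP->|/Ps].
Qed.

(** A derivation uses finitely many relations; transitivity and concatenation split the error in
    two. *)
Lemma word_eq_eventually u v (eps : R) : word_eq free_rels u v -> (0 < eps)%R ->
  eventually (fun Z m => rare eps [pred z | word_prod m u z != word_prod m v z]).
Proof.
have triv P : (forall Z m, P Z m) -> eventually P by exists [::], [::], 1%R; split.
move=> uv; elim: uv eps => {u v}.
- move=> u eps eps0; apply: triv => Z m.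
  by apply: rare0 => [|z /=]; [exact: ltW|rewrite eqxx].
- move=> u v _ IH eps /IH[Lg [Lh [d [d0 ev]]]]; exists Lg, Lh, d; split=> // Z m /ev.
  by apply: rareS => z /=; rewrite eq_sym.
- move=> u v w _ IH1 _ IH2 eps eps0; have eps2 : (0 < eps / 2%:R)%R by rewrite divr_gt0.
  have [Lg [Lh [d [d0 ev]]]] := eventually_and (IH1 _ eps2) (IH2 _ eps2).
  exists Lg, Lh, d; split=> // Z m /ev[r1 r2].
  rewrite [eps]splitr; apply: rareS (rareU r1 r2) => z /=.
  by case: (word_prod m u z =P word_prod m v z) => //= ->.
- move=> u u' v v' _ IH1 _ IH2 eps eps0; have eps2 : (0 < eps / 2%:R)%R by rewrite divr_gt0.
  have [Lg [Lh [d [d0 ev]]]] := eventually_and (IH1 _ eps2) (IH2 _ eps2).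
  exists Lg, Lh, d; split=> // Z m /ev[r1 r2].
  rewrite [eps]splitr.
  apply: rareS (rareU r1 (rare_inj (@perm_inj _ (word_prod m u')) r2)) => z /=.
  rewrite !word_prod_cat !permM; case: (word_prod m u z =P _) => //= ->.
  by [].
- move=> x b eps eps0; apply: triv => Z m.
  apply: rare0 => [|z /=]; first exact: ltW.
  rewrite word_prod_cons word_prod1 /word_prod big_nil negbK /=.
  by case: b => /=; rewrite ?mulgV ?mulVg.
- move=> _ _ [v g h|e h|//] eps eps0.
  + exists [:: Tagged (@vgroup GG) g; Tagged (@vgroup GG) h], [::], eps.
    by split=> // Z m [mg _]; apply: mg; rewrite !inE eqxx ?orbT.
  + exists [::], [:: Tagged (@egroup GG) h], eps.
    by split=> // Z m [_ mh]; apply: mh; rewrite !inE eqxx.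
Qed.

End Soundness.

(** * Soficity of the fundamental group *)

Theorem theorem1p2 (R : realType) (GG : graph_of_groups) (T : set (edge GG))
    (T_tree : spanning_tree T)
    (vertex_sofic : forall v : vertex GG, sofic R (@vgroup GG v))
    (edge_amenable : forall e : edge GG, amenable R (@egroup GG e)) :
  sofic R (@pi1 GG T).
Proof.
apply: weakly_sofic_sofic => eps F eps0.
case: T_tree => -[[v0 _] connT] acyT.
have /choice[P PT] v : exists p, walk_in T v0 p v by exact: connT.
(* Loops in the path group multiply modulo vertex and edge relations only, which are the ones that
   models respect. *)
pose code (g : pi1 T) := loop_word P (wrepr g).
have codeM g h : word_eq (@pi1_rels GG set0) (code (g * h)) (code g ++ code h).
  rewrite /code -loop_word_cat; apply: (loop_word_eq acyT PT).
  exact: wrepr_class.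
have /choice[nf nfP] (g : pi1 T) : exists p : gtag GG * seq (dart GG * gtag GG),
    [/\ reduced p.2, g <> 1 -> p.2 = [::] -> tagged p.1 <> 1 &
     word_eq (@pi1_rels GG set0) (code g) (form_word p.1 p.2)].
  have [k [l [rl _ /wclassP eg]]] := reduced_form (path_loop_word PT (wrepr g)).
  (* If the form were just [1], the loop of [g] would be trivial in the path group, and hence [g] in
     [pi1 T]. *)
  exists (Tagged (@vgroup GG) k, l); split=> //= g1 l0 k1; apply: g1.
  rewrite -[g]wreprK -(loop_word_pi1 PT); apply/wclassP.
  apply: (word_eq_sub (r := @pi1_rels GG set0)).
    by move=> a b [v x y|e x|//]; [exact: pi1_vertex|exact: pi1_edge].
  apply: word_eq_trans eg _; rewrite l0 k1; apply/wclassP; exact: vletter1.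
have eps2 : (0 < eps / 2%:R)%R by rewrite divr_gt0.
have evM : eventually R (fun Z (m : pi1_gen GG -> {perm Z}) => {in [seq (g, h) | g <- F, h <- F],
    forall p : pi1 T * pi1 T, rare eps [pred z | word_prod m (code (p.1 * p.2)) z
      != word_prod m (code p.1 ++ code p.2) z]}).
  by apply: eventually_all => p _; exact: word_eq_eventually.
have evF : eventually R (fun Z (m : pi1_gen GG -> {perm Z}) => {in F, forall g, rare (eps / 2%:R)%R
    [pred z | word_prod m (code g) z != word_prod m (form_word (nf g).1 (nf g).2) z]}).
  by apply: eventually_all => g _; apply: word_eq_eventually => //; case: (nfP g).
have [Lg [Lh [d [d0 ev]]]] := eventually_and evM evF.
(* The bound [d] makes [ev] applicable; one half of [eps] bounds the fixed points of the form, the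
   other its difference from [code g]. *)
have dmin : (0 < Num.min d (eps / 2%:R))%R by rewrite lt_min d0.
have [|Z [m [Z0 mg mh mW]]] := @models_exist R GG vertex_sofic edge_amenable Lg Lh
    [seq nf g | g <- F & g != 1] _ dmin.
  move=> p /mapP[g]; rewrite mem_filter => /andP[/eqP g1 _] ->.
  by have [rl nt _] := nfP g; split=> //; exact: nt.
have [rM rF] : {in [seq (g, h) | g <- F, h <- F], forall p : pi1 T * pi1 T,
      rare eps [pred z | word_prod m (code (p.1 * p.2)) z
        != word_prod m (code p.1 ++ code p.2) z]} /\
    {in F, forall g, rare (eps / 2%:R)%R
      [pred z | word_prod m (code g) z != word_prod m (form_word (nf g).1 (nf g).2) z]}.
  apply: ev; apply: (respects_sub (Lg := Lg) (Lh := Lh)) (conj mg mh) => //.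
  by rewrite ge_min lexx.
exists Z, (fun g => word_prod m (code g)); split=> //.
- move=> g h gF hF; apply: rareS (rM (g, h) _) => [z /=|].
    by rewrite word_prod_cat permM.
  by apply/allpairsP; exists (g, h).
- move=> g gF g1; rewrite [eps]splitr; apply: rareS (rareU (rF g gF) _) => [z|].
    2: apply: rare_le (mW (nf g) _).
  + by move=> /= /eqP e; rewrite e eq_sym; case: eqP.
  + by rewrite ge_min lexx orbT.
  + by apply: map_f; rewrite mem_filter gF andbT; exact/eqP.
Qed.
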